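(* For every $k\ge0$ and every $n$-simplex $K$, $$\mathcal P_{k+1}(K;\mathbb S)=\Sigma_{k+1,h,b}(K)\oplus\tilde\Sigma_{k+1,h,f}(K)\oplus\tilde\Sigma_{k+1,h,b}(K).$$
   Context: Let $n\ge2$ and let $K\subset\mathbb R^n$ be an $n$-simplex with vertices $a_1,\dots,a_{n+1}$, barycentric coordinates $\lambda_1,\dots,\lambda_{n+1}$, and put $\lambda_0:=1$. $F_i$ is the face not containing $a_i$; the restrictions of $\lambda_l$ ($l\ne i$, $l\geq 1$) to $F_i$ are the barycentric coordinates of $F_i$ (same notation). $t_{ij}=(a_j-a_i)/|a_j-a_i|$. $\mathbb S$ is the space of real symmetric $n\times n$ matrices. $\mathcal P_m(D;X)$ denotes $X$-valued polynomials of degree $\le m$ on $D$ ($\{0\}$ if $m<0$). $\mathcal P_k^{\hat0,\hat i}(K;\mathbb R):=\mathrm{span}\{\prod_{l=1,l\ne i}^{n+1}\lambda_l^{m_l}:\sum_{l\ne i}m_l=k\}$. For $i\neq j$ in $\{1,\dots,n+1\}$, the extension operator $\mathcal E_j^{\hat i}:\mathcal P_{k+1}(F_j;\mathbb R)\to\mathcal P_{k+1}(K;\mathbb R)$ writes $p$ uniquely as a linear combination of the monomials $\prod_{l=0,l\ne i,j}^{n+1}\lambda_l^{m_l}$, $\sum m_l=k+1$, in the barycentric coordinates of $F_j$ and returns the same combination of the barycentric coordinates of $K$. $\mathcal P_k^\perp(F_j;\mathbb R)$ is the $L^2(F_j)$-orthogonal complement of $\mathcal P_k(F_j;\mathbb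 R)$ in $\mathcal P_{k+1}(F_j;\mathbb R)$. Finally $$\Sigma_{k+1,h,b}(K):=\bigoplus_{1\le i<j\le n+1}\lambda_i\lambda_j\mathcal P_{k-1}(K;\mathbb R)\,t_{ij}t_{ij}^T,$$ $$\tilde\Sigma_{k+1,h,f}(K):=\bigoplus_{1\le i<j\le n+1}\left(\lambda_i\mathcal P_k^{\hat0,\hat j}(K;\mathbb R)\oplus\lambda_j\mathcal P_k^{\hat0,\hat i}(K;\mathbb R)\right)t_{ij}t_{ij}^T,$$ $$\tilde\Sigma_{k+1,h,b}(K):=\bigoplus_{1\le i<j\le n+1}\mathcal E_j^{\hat i}\mathcal P_k^\perp(F_j;\mathbb R)\,t_{ij}t_{ij}^T.$$ *)

(* Defs.v *)
From HB Require Import structures.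
From mathcomp Require Import all_boot all_order all_algebra.
From mathcomp Require Import all_classical all_reals all_analysis.

Unset Printing Implicit Defensive.
Import Order.TTheory GRing.Theory Num.Theory.
Import numFieldNormedType.Exports.

Local Open Scope classical_set_scope.
Local Open Scope ring_scope.

(** * Spans and internal direct sums *)

Definition lspan {R : pzRingType} {V : lmodType R} (S : set V) : set V :=
  [set v | exists (m : nat) (c : 'I_m -> R) (s : 'I_m -> V),
     (forall i, S (s i)) /\ v = \sum_(i < m) c i *: s i].

Definition sum_of {V : nmodType} {I : finType} (W : I -> set V) : set V :=
  [set v | exists2 w : I -> V, forall i, W i (w i) & v = \sum_i w i].

Definition direct {V : nmodType} {I : finType} (W : I -> set V) : Prop :=
  forall w w' : I -> V, (forall i, W i (w i)) -> (forall i, W i (w' i)) ->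
    \sum_i w i = \sum_i w' i -> w = w'.

Definition is_direct_sum {V : nmodType} {I : finType}
    (S : set V) (W : I -> set V) : Prop :=
  direct W /\ S = sum_of W.

(** * Lebesgue measure on [R^m], carried by [m.-tuple R] *)

Section lebesgue_tuple.
Context {R : realType}.
Let T := measurableTypeR R.

Definition tuple_cons {m} (xt : T * m.-tuple T) : m.+1.-tuple T :=
  [the m.+1.-tuple T of xt.1 :: xt.2].

Lemma measurable_tuple_cons m : measurable_fun setT (@tuple_cons m).
Proof. exact: measurable_cons. Qed.

Section cons.
Context {m : nat} (mu : {sigma_finite_measure set (m.-tuple T) -> \bar R}).

Definition lebesgue_cons : set (m.+1.-tuple T) -> \bar R :=
  pushforward (@lebesgue_measure R \x mu)%E (@tuple_cons m).

Let lebesgue_cons0 : lebesgue_cons set0 = 0%E.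
Proof. by rewrite /lebesgue_cons /pushforward preimage_set0 measure0. Qed.

Let lebesgue_cons_ge0 A : (0 <= lebesgue_cons A)%E.
Proof. by rewrite /lebesgue_cons /pushforward measure_ge0. Qed.

Let lebesgue_cons_sigma_additive : semi_sigma_additive lebesgue_cons.
Proof.
move=> F mF tF _; rewrite /lebesgue_cons /pushforward preimage_bigcup.
have mpF i : measurable (@tuple_cons m @^-1` F i).
  by rewrite -[X in measurable X]setTI; exact: measurable_tuple_cons.
apply: measure_semi_sigma_additive => //; last exact: bigcup_measurable.
apply/trivIsetP => /= i j _ _ ij; rewrite -preimage_setI.
by move/trivIsetP : tF => /(_ _ _ _ _ ij) ->//; rewrite preimage_set0.
Qed.

HB.instance Definition _ := isMeasure.Build _ _ _ lebesgue_cons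
  lebesgue_cons0 lebesgue_cons_ge0 lebesgue_cons_sigma_additive.

Let lebesgue_cons_sigma_finite : sigma_finite setT lebesgue_cons.
Proof.
have /sigma_finiteP[F [TF ndF Foo]] := sigma_finiteT (@lebesgue_measure R).
have /sigma_finiteP[G [TG ndG Goo]] := sigma_finiteT mu.
pose u (t : m.+1.-tuple T) : T * m.-tuple T := (thead t, [tuple of behead t]).
have uK : cancel u (@tuple_cons m).
  by move=> t; rewrite /u /tuple_cons/= [RHS]tuple_eta; apply: val_inj.
have consK : cancel (@tuple_cons m) u.
  by move=> [x t]; rewrite /u /tuple_cons/=; congr (_, _); apply: val_inj.
have mu_ : measurable_fun setT u.
  apply/measurable_fun_pairP; split.
    exact: measurable_tnth.
  exact: measurable_behead.
exists (fun i => u @^-1` (F i `*` G i)).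
  rewrite -preimage_bigcup [X in _ @^-1` X](_ : _ = setT) ?preimage_setT//.
  apply/seteqP; split => // -[x y] _.
  have [i _ Fix] : (\bigcup_i F i) x by rewrite -TF.
  have [j _ Gjy] : (\bigcup_i G i) y by rewrite -TG.
  exists (maxn i j) => //; split => /=.
  - by move: x Fix; exact/subsetPset/ndF/leq_maxl.
  - by move: y Gjy; exact/subsetPset/ndG/leq_maxr.
move=> i; have [mF Fioo] := Foo i; have [mG Gioo] := Goo i; split.
  by rewrite -[X in measurable X]setTI; apply: mu_ => //; exact: measurableX.
rewrite /lebesgue_cons /pushforward.
rewrite (_ : _ @^-1` _ = F i `*` G i); last first.
  by apply/funext => x; rewrite /preimage /mkset consK.
by rewrite product_measure1E// lte_mul_pinfty// ge0_fin_numE.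
Qed.

HB.instance Definition _ := Measure_isSigmaFinite.Build _ _ _ lebesgue_cons
  lebesgue_cons_sigma_finite.

End cons.

Fixpoint lebesgue_tuple (m : nat) :
    {sigma_finite_measure set (m.-tuple T) -> \bar R} :=
  match m return {sigma_finite_measure set (m.-tuple T) -> \bar R} with
  | 0 => \d_ [tuple]
  | m'.+1 => lebesgue_cons (lebesgue_tuple m')
  end.

End lebesgue_tuple.

(** * Polynomials on subsets of [R^n] *)

Section polynomials.
Context {R : realType} {n : nat}.
Implicit Types D : set 'cV[R]_n.

(* Functions on [D] are functions on the subtype [D], so that polynomials are
   identified when they agree on [D]. The degree bound is an integer: for
   [d < 0] there is no admissible monomial, and the span is [{0}]. *)
Definition poly_on D {V : lmodType R} (X : set V) (d : int) : set (D -> V) :=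
  lspan [set f | exists (al : 'I_n -> nat) (c : V),
    [/\ ((\sum_(l < n) al l)%N%:Z <= d)%R, X c &
        f = fun x : D => (\prod_(l < n) val x l ord0 ^+ al l) *: c]].

Definition real_poly D (d : int) : set (D -> R) :=
  poly_on D [set: (R : lmodType R)] d.

Definition sym_mx : set 'M[R]_n := [set A | A^T = A].

Definition sym_poly D (d : int) : set (D -> 'M[R]_n) := poly_on D sym_mx d.

Definition enorm (v : 'cV[R]_n) : R := Num.sqrt (\sum_(l < n) v l ord0 ^+ 2).

End polynomials.

(** * Simplices *)

Definition edge_index (n : nat) : finType :=
  {ij : 'I_n.+1 * 'I_n.+1 | (ij.1 < ij.2)%N}.

Section simplex.
Context {R : realType} {n : nat} (a : 'I_n.+1 -> 'cV[R]_n).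

Definition affinely_independent : Prop :=
  forall c : 'I_n.+1 -> R, \sum_i c i = 0 -> \sum_i c i *: a i = 0 ->
    forall i, c i = 0.

Definition hull (A : {pred 'I_n.+1}) : set 'cV[R]_n :=
  [set x | exists c : 'I_n.+1 -> R,
    [/\ forall i, 0 <= c i, forall i, i \notin A -> c i = 0,
        \sum_i c i = 1 & x = \sum_i c i *: a i]].

Definition simplex : set 'cV[R]_n := hull predT.

Definition face (j : 'I_n.+1) : set 'cV[R]_n := hull (predC1 j).

Definition barycentric (x : 'cV[R]_n) : 'I_n.+1 -> R :=
  xget (fun=> 0) [set c | \sum_i c i = 1 /\ x = \sum_i c i *: a i].

(* The index [None] stands for the additional index [0], [lambda_0 = 1]. *)
Definition lam (l : option 'I_n.+1) (x : 'cV[R]_n) : R :=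
  if l is Some i then barycentric x i else 1.

Definition edge_dir (i j : 'I_n.+1) : 'cV[R]_n :=
  (enorm (a j - a i))^-1 *: (a j - a i).

Definition edge_mx (i j : 'I_n.+1) : 'M[R]_n :=
  edge_dir i j *m (edge_dir i j)^T.

(** ** Monomials in the barycentric coordinates *)

Definition multi_index (d : nat) := {ffun option 'I_n.+1 -> 'I_d.+1}.

(* Exponents of total degree [d] that vanish on the hatted indices [h]. *)
Definition hat_exps {d : nat} (h : seq (option 'I_n.+1)) :
    pred (multi_index d) :=
  fun al => (\sum_l (al l : nat) == d)%N && all (fun l => al l == 0 :> nat) h.

Definition bary_mono (D : set 'cV[R]_n) {d : nat} (al : multi_index d) :
    D -> R :=
  fun x => \prod_l lam l (val x) ^+ al l.

Definition hat_poly (D : set 'cV[R]_n) (d : nat) (h : seq (option 'I_n.+1)) :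
    set (D -> R) :=
  lspan [set bary_mono D al | al in [set al : multi_index d | hat_exps h al]].

Definition bary_comb (D : set 'cV[R]_n) {d : nat} (h : seq (option 'I_n.+1))
    (c : multi_index d -> R) : D -> R :=
  fun x => \sum_(al | hat_exps h al) c al * bary_mono D al x.

Definition extension (d : nat) (i j : 'I_n.+1) (p : face j -> R) :
    simplex -> R :=
  xget (fun=> 0) [set q | exists c : multi_index d -> R,
    p = bary_comb (face j) [:: Some i; Some j] c /\
    q = bary_comb simplex [:: Some i; Some j] c].

(** ** [L^2] orthogonality on a face *)

Definition face_vertices (j : 'I_n.+1) : seq 'cV[R]_n :=
  [seq a (lift j l) | l <- enum 'I_n].

Definition face_edges (j : 'I_n.+1) : 'M[R]_(n, n.-1) :=
  \matrix_(r < n, l < n.-1)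
    ((face_vertices j)`_l.+1 - (face_vertices j)`_0) r ord0.

Definition face_chart (j : 'I_n.+1) (s : n.-1.-tuple R) : 'cV[R]_n :=
  (face_vertices j)`_0 + face_edges j *m \col_(l < n.-1) tnth s l.

(* Integral for the [(n-1)]-dimensional surface measure of the face, pulled
   back along the affine chart; the square root is its Gram factor. *)
Definition face_integral (j : 'I_n.+1) (f : 'cV[R]_n -> R) : R :=
  Num.sqrt (\det ((face_edges j)^T *m face_edges j)) *
  \int[lebesgue_tuple n.-1]_(s in face_chart j @^-1` face j)
    f (face_chart j s).

(* ['valL_0] extends a function on the face by zero. *)
Definition face_dot {j : 'I_n.+1} (p q : face j -> R) : R :=
  face_integral j (fun x => 'valL_0 p x * 'valL_0 q x).

Definition perp_poly (j : 'I_n.+1) (k : nat) : set (face j -> R) :=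
  [set p | real_poly (face j) k.+1%:Z p /\
           forall q, real_poly (face j) k%:Z q -> face_dot p q = 0].

(** ** The three families of subspaces *)

Definition times_lam (i : 'I_n.+1) (W : set (simplex -> R)) :
    set (simplex -> R) :=
  [set (fun x => lam (Some i) (val x) * p x) | p in W].

Definition times_mx (W : set (simplex -> R)) (A : 'M[R]_n) :
    set (simplex -> 'M[R]_n) :=
  [set (fun x => p x *: A) | p in W].

Definition Sigma_hb_fam (k : nat) (e : edge_index n) :
    set (simplex -> 'M[R]_n) :=
  let: (i, j) := val e in
  times_mx (times_lam i (times_lam j (real_poly simplex (k%:Z - 1))))
    (edge_mx i j).

Definition Sigma_hb (k : nat) := sum_of (Sigma_hb_fam k).

Definition tSigma_hf_pair (k : nat) (e : edge_index n) :
    'I_2 -> set (simplex -> R) :=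
  let: (i, j) := val e in
  tnth [tuple times_lam i (hat_poly simplex k [:: None; Some j]);
              times_lam j (hat_poly simplex k [:: None; Some i])].

Definition tSigma_hf_fam (k : nat) (e : edge_index n) :
    set (simplex -> 'M[R]_n) :=
  let: (i, j) := val e in
  times_mx (sum_of (tSigma_hf_pair k e)) (edge_mx i j).

Definition tSigma_hf (k : nat) := sum_of (tSigma_hf_fam k).

Definition tSigma_hb_fam (k : nat) (e : edge_index n) :
    set (simplex -> 'M[R]_n) :=
  let: (i, j) := val e in
  times_mx (extension k.+1 i j @` perp_poly j k) (edge_mx i j).

Definition tSigma_hb (k : nat) := sum_of (tSigma_hb_fam k).

End simplex.

(* Main.v *)
Require Import Defs.
From HB Require Import structures.
From mathcomp Require Import all_boot all_order all_algebra.
From mathcomp Require Import all_classical all_reals all_analysis.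
From mathcomp Require Import measurable_realfun ring lra.
Import Order.TTheory GRing.Theory Num.Theory.
Import numFieldNormedType.Exports.
Local Open Scope classical_set_scope.
Local Open Scope ring_scope.

(** The rank-one matrices attached to the edges of the simplex form a basis of
    the symmetric matrices: if [g_p] is the gradient of the barycentric
    coordinate [lambda_p], the numbers [g_p^T A g_q], [p < q], are dual to them
    up to nonzero factors ([grad_form_edges]) and determine a symmetric [A]
    ([sym_grad_form_inj]). So the theorem is the direct sum, over the edges, of
    one scalar statement ([mx_direct_sum], [edge_space_direct_sum]): for
    [i != j], every polynomial of degree [k + 1] is uniquely

      [lambda_i lambda_j u + (lambda_i v + lambda_j w) + E p]

    with [v] homogeneous in the [lambda_l], [l != j], with [w] homogeneous in
    the [lambda_l], [l != i], and with [p] on [F_j] orthogonal to degree [k].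

    The extension operator is composition with a map: [E p = p o slide], where
    [slide] projects the simplex onto [F_j] along the edge from [a_j] to [a_i]
    ([extension_slide]). Indeed [slide] preserves all [lambda_l] with
    [l != i, j], and only these occur in the expansion of [p] that [E] uses.

    Existence ([edge_decomposition]). Sorting homogeneous monomials by the
    presence of [lambda_i] and [lambda_j] leaves a form [g] in the remaining
    coordinates, which is [g' o slide] for its restriction [g'] to [F_j]. The
    bilinear form [(q, r) |-> \int lambda_i q r] is positive definite on the
    polynomials of degree [k] on [F_j], so some [q] makes [g' - lambda_i q]
    orthogonal to all of them ([face_int_riesz]). Composing with [slide] turns
    [lambda_i] into [lambda_i + lambda_j], hence the correction
    [(lambda_i q) o slide] lies in the first two summands.

    Uniqueness ([edge_direct]). On [lambda_i = lambda_j = 0] a vanishing sum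
    reduces to [p = 0], so [p = lambda_i q] on [F_j] with [q] of degree [k];
    then [\int lambda_i q^2 = 0] and [p = 0] ([perp_eq0]). On [lambda_j = 0]
    what is left reduces to [lambda_i v = 0], and a form of positive degree in
    the [lambda_l], [l != j], that vanishes on [F_j] vanishes everywhere by
    homogeneity ([form_hull_eq0]). By symmetry [lambda_j w = 0] as well.

    All polynomials are handled as functions, through the predicate [form]; no
    linear independence of monomials enters the argument. *)

(** * Homogeneous polynomial functions *)

Section forms.
Context {R : realType}.

(** [form Y d f]: [f] is a homogeneous polynomial of degree [d] in the functions
    of [Y]. Only the function matters, not its expression, so that one [f] may
    be a form in several degrees and for several [Y]. *)
Inductive form {T : Type} (Y : set (T -> R)) : nat -> (T -> R) -> Prop :=
| form_cst c : form Y 0 (fun=> c)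
| form_zero d : form Y d (fun=> 0)
| form_add d f g : form Y d f -> form Y d g -> form Y d (fun x => f x + g x)
| form_genM d y f : Y y -> form Y d f -> form Y d.+1 (fun x => y x * f x).

Section one_type.
Context {T : Type}.
Implicit Types (Y Z : set (T -> R)) (f g : T -> R) (d e : nat).

Lemma form_ext Y d f g : f =1 g -> form Y d f -> form Y d g.
Proof. by move=> /funext ->. Qed.

Lemma form_scale Y d c f : form Y d f -> form Y d (fun x => c * f x).
Proof.
elim=> [b|e|e g h _ ihg _ ihh|e y g Yy _ ih].
- exact: form_cst.
- by apply: (form_ext _ _ _ _ _ (form_zero Y e)) => x; rewrite mulr0.
- by apply: (form_ext _ _ _ _ _ (form_add _ _ _ _ ihg ihh)) => x; rewrite mulrDr.
- by apply: (form_ext _ _ _ _ _ (form_genM _ _ _ _ Yy ih)) => x; rewrite mulrCA.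
Qed.

Lemma form_opp Y d f : form Y d f -> form Y d (fun x => - f x).
Proof.
by move=> /(form_scale _ _ (-1)); apply: form_ext => x; rewrite mulN1r.
Qed.

Lemma form_sub Y d f g :
  form Y d f -> form Y d g -> form Y d (fun x => f x - g x).
Proof. by move=> Yf Yg; apply: form_add => //; exact: form_opp. Qed.

Lemma form_sum Y d (I : Type) (r : seq I) (P : pred I) (F : I -> T -> R) :
  (forall i, P i -> form Y d (F i)) ->
  form Y d (fun x => \sum_(i <- r | P i) F i x).
Proof.
move=> YF; elim: r => [|i r ih].
  by apply: (form_ext _ _ _ _ _ (form_zero Y d)) => x; rewrite big_nil.
case Pi: (P i); last first.
  by apply: form_ext ih => x; rewrite big_cons Pi.
by apply: form_ext (form_add _ _ _ _ (YF i Pi) ih) => x; rewrite big_cons Pi.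
Qed.

Lemma form_gen Y y : Y y -> form Y 1 y.
Proof.
move=> Yy; apply: form_ext (form_genM _ _ _ _ Yy (form_cst Y 1)) => x.
by rewrite mulr1.
Qed.

Lemma form_mul Y d e f g :
  form Y d f -> form Y e g -> form Y (d + e) (fun x => f x * g x).
Proof.
move=> Yf Yg; elim: Yf => [c|{}d|{}d f1 f2 _ ih1 _ ih2|{}d y {}f Yy _ ih].
- exact: form_scale.
- by apply: form_ext (form_zero _ _) => x; rewrite mul0r.
- by apply: form_ext (form_add _ _ _ _ ih1 ih2) => x; rewrite mulrDl.
- by apply: form_ext (form_genM _ _ _ _ Yy ih) => x; rewrite mulrA.
Qed.

Lemma form_lower Y d f : form Y 1 (fun=> 1) -> form Y d f -> form Y d.+1 f.
Proof.
move=> Y1 Yf; apply: form_ext (form_mul _ _ _ _ _ Y1 Yf) => x.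
by rewrite mul1r.
Qed.

Lemma form_lower_le Y d e f :
  form Y 1 (fun=> 1) -> (d <= e)%N -> form Y d f -> form Y e f.
Proof.
move=> Y1 /subnK <-; move: (e - d)%N => p Yf.
by elim: p => // p ih; rewrite addSn; exact: form_lower.
Qed.

(** Sort the monomials: those divisible by [y0] go to the first part, the others
    only use generators of [Z]. *)
Lemma form_split Y Z y0 d f :
  (forall y, Y y -> y = y0 \/ Z y) -> Z `<=` Y -> form Y d.+1 f ->
  exists g h, [/\ form Y d g, form Z d.+1 h &
                  f = fun x => y0 x * g x + h x].
Proof.
move=> YZ sZY Yf; move De: d.+1 Yf => e Yf.
suff : (if e is d'.+1 then exists g h, [/\ form Y d' g, form Z d'.+1 h &
    f = fun x => y0 x * g x + h x] else exists c, f = fun=> c) : Prop.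
  by rewrite -De.
elim: Yf => {d f e De} [c|[|d]|[|d] f1 f2 _ ih1 _ ih2|d y f Yy Yf ih].
- by exists c.
- by exists 0.
- exists (fun=> 0), (fun=> 0); split; [exact: form_zero..|].
  by apply/funext => x; rewrite mulr0 addr0.
- by case: ih1 ih2 => c -> [c' ->]; exists (c + c').
- case: ih1 ih2 => g1 [h1 [Yg1 Zh1 ->]] [g2 [h2 [Yg2 Zh2 ->]]].
  exists (fun x => g1 x + g2 x), (fun x => h1 x + h2 x).
  by split; [exact: form_add..|apply/funext => x; rewrite mulrDr addrACA].
- have [->|Zy] := YZ _ Yy.
    exists f, (fun=> 0); split=> //; first exact: form_zero.
    by apply/funext => x; rewrite addr0.
  case: d Yf ih => [|d] Yf.
    move=> [c ->]; exists (fun=> 0), (fun x => y x * c); split.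
    + exact: form_zero.
    + exact: (form_genM _ _ _ (fun=> c) Zy (form_cst _ _)).
    + by apply/funext => x; rewrite mulr0 add0r.
  move=> [g [h [Yg Zh ->]]]; exists (fun x => y x * g x), (fun x => y x * h x).
  split; [exact: form_genM..|apply/funext => x].
  by rewrite mulrDr mulrCA.
Qed.

Lemma form_homogeneous Y d f c x x' :
  (forall y, Y y -> y x = c * y x') -> form Y d f -> f x = c ^+ d * f x'.
Proof.
move=> Yc; elim=> [b|e|e g h _ ihg _ ihh|e y g Yy _ ih].
- by rewrite mul1r.
- by rewrite mulr0.
- by rewrite ihg ihh mulrDr.
- by rewrite ih Yc// exprS mulrACA.
Qed.

End one_type.

(** Substitution, for generators that are only known to match along a relation
    [r] between the two domains: this lets a form on a subset be continued to a
    form on a larger domain. *)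
Lemma form_transfer {T U : Type} (Y : set (T -> R)) (Z : set (U -> R))
    (r : U -> T -> Prop) d f :
  (forall y, Y y -> exists2 z, form Z 1 z & forall u t, r u t -> z u = y t) ->
  form Y d f -> exists2 g, form Z d g & forall u t, r u t -> g u = f t.
Proof.
move=> YZ; elim=> [c|e|e g h _ [g' Zg gE] _ [h' Zh hE]|e y g Yy _ [g' Zg gE]].
- by exists (fun=> c) => //; exact: form_cst.
- by exists (fun=> 0) => //; exact: form_zero.
- exists (fun x => g' x + h' x); first exact: form_add.
  by move=> u t rut; rewrite (gE _ _ rut) (hE _ _ rut).
- have [z Zz zE] := YZ _ Yy.
  exists (fun x => z x * g' x); first by rewrite -add1n; exact: form_mul.
  by move=> u t rut; rewrite (gE _ _ rut) (zE _ _ rut).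
Qed.

Lemma form_comp {T U : Type} (Y : set (T -> R)) (Z : set (U -> R))
    (phi : U -> T) d f :
  (forall y, Y y -> form Z 1 (fun u => y (phi u))) ->
  form Y d f -> form Z d (fun u => f (phi u)).
Proof.
move=> YZ Yf; have [] := form_transfer Y Z (fun u t => t = phi u) d f _ Yf.
  by move=> y Yy; exists (fun u => y (phi u)); [exact: YZ|move=> u t ->].
by move=> g Zg gE; apply: form_ext Zg => u; exact: gE.
Qed.

Lemma form_change {T : Type} (Y Z : set (T -> R)) d f :
  (forall y, Y y -> form Z 1 y) -> form Y d f -> form Z d f.
Proof. exact: (form_comp Y Z id). Qed.

End forms.

(** * Finite spans *)

Section spans.
Context {R : realType}.

Lemma lspan_fin {V : lmodType R} {T : finType} (P : pred T) (F : T -> V) v :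
  lspan [set F t | t in [set t | P t]] v <->
  exists c : T -> R, v = \sum_(t | P t) c t *: F t.
Proof.
split=> [[m [c [s [sP ->]]]]|[c ->]].
  have /choice[u uP] : forall i, exists t, P t /\ F t = s i.
    by move=> i; have [t Pt <-] := sP i; exists t.
  exists (fun t => \sum_(i | u i == t) c i).
  under [RHS]eq_bigr do rewrite scaler_suml.
  rewrite (exchange_big_dep predT)//=; apply: eq_bigr => i _.
  rewrite (big_pred1 (u i)) ?(uP i).2// => t.
  by rewrite !inE eq_sym; case: eqP => [->|]; rewrite ?andbF ?(uP i).1.
exists #|P|, (fun i => c (enum_val i)), (fun i => F (enum_val i)); split.
  by move=> i; exists (enum_val i) => //; exact: (enum_valP i).
by rewrite big_enum_val.
Qed.

Lemma lspan_ind {V : lmodType R} (S : set V) (Q : V -> Prop) :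
  Q 0 -> (forall u v, Q u -> Q v -> Q (u + v)) ->
  (forall c v, S v -> Q (c *: v)) -> forall v, lspan S v -> Q v.
Proof.
move=> Q0 QD QZ v [m [c [s [sP ->]]]].
by elim/big_ind : _ => // i _; apply: QZ.
Qed.

Lemma lspan_add {V : lmodType R} (S : set V) u v :
  lspan S u -> lspan S v -> lspan S (u + v).
Proof.
move=> [m [c [s [sP ->]]]] [m' [c' [s' [sP' ->]]]].
exists (m + m')%N, (fun i => match fintype.split i with inl i => c i | inr i => c' i end).
exists (fun i => match fintype.split i with inl i => s i | inr i => s' i end); split.
  by move=> i; case: splitP.
rewrite big_split_ord; congr +%R; apply: eq_bigr => i _.
  by rewrite (unsplitK (inl i)).
by rewrite (unsplitK (inr i)).
Qed.

Lemma lspan_zero {V : lmodType R} (S : set V) : lspan S 0.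
Proof.
by exists 0%N, (fun=> 0), (fun=> 0); split; [case|rewrite big_ord0].
Qed.

Lemma lspan_gen {V : lmodType R} (S : set V) c v : S v -> lspan S (c *: v).
Proof.
by exists 1%N, (fun=> c), (fun=> v); split=> //; rewrite big_ord1.
Qed.

End spans.

(** * Polynomials and barycentric combinations as forms *)

Lemma sum_nat_delta {I : finType} (i : I) : (\sum_j (j == i : nat) = 1)%N.
Proof. by rewrite (bigD1 i)//= eqxx big1 ?addn0// => j /negPf ->. Qed.

Section polynomials_as_forms.
Context {R : realType} {n : nat}.
Implicit Types (D : set 'cV[R]_n).

Lemma form_exp {T : Type} (Y : set (T -> R)) e y :
  form Y 1 y -> form Y e (fun x => y x ^+ e).
Proof.
move=> Yy; elim: e => [|e ih]; first exact: (form_cst Y 1).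
by apply: form_ext (form_mul _ _ _ _ _ Yy ih) => x; rewrite exprS.
Qed.

Lemma form_monomial {T I : Type} (Y : set (T -> R)) (r : seq I) (e : I -> nat)
    (y : I -> T -> R) :
  (forall i, e i != 0 -> form Y 1 (y i)) ->
  form Y (\sum_(i <- r) e i) (fun x => \prod_(i <- r) y i x ^+ e i).
Proof.
move=> Yy; elim: r => [|i r ih].
  by rewrite big_nil; apply: form_ext (form_cst Y 1) => x; rewrite big_nil.
rewrite big_cons; case: (eqVneq (e i) 0) => [e0|e0].
  by rewrite e0 add0n; apply: form_ext ih => x; rewrite big_cons e0 mul1r.
apply: form_ext (form_mul _ _ _ _ _ (form_exp _ (e i) _ (Yy _ e0)) ih) => x.
by rewrite big_cons.
Qed.

(** With the constant [1] among the generators, forms of degree [d] are the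
    polynomials of degree at most [d]. *)
Definition coord_gens D : set (D -> R) :=
  [set y | y = (fun=> 1) \/ exists l, y = fun x : D => val x l ord0].

Lemma coord_gens_lower D : form (coord_gens D) 1 (fun=> 1).
Proof. by apply: form_gen; left. Qed.

Lemma real_polyP D d (f : D -> R) :
  real_poly D d%:Z f <-> form (coord_gens D) d f.
Proof.
split.
  apply: lspan_ind => [|u v|c v [al [c' [ald _ ->]]]].
  - exact: form_zero.
  - exact: form_add.
  - have Yx : form (coord_gens D) (\sum_(l < n) al l)
        (fun x : D => \prod_(l < n) val x l ord0 ^+ al l).
      apply: (form_monomial _ _ _ (fun l (x : D) => val x l ord0)) => l _.
      by apply: form_gen; right; exists l.
    move: ald; rewrite lez_nat => ald.
    have {Yx} := form_scale _ _ (c * c') _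
      (form_lower_le _ _ _ _ (coord_gens_lower D) ald Yx).
    apply: form_ext => x.
    by rewrite /GRing.scale/= /GRing.scale/= mulrAC mulrA.
elim=> {d f}.
- move=> c; rewrite (_ : (fun=> c) = c *: (fun=> 1)); last first.
    by apply/funext => x; rewrite /GRing.scale/= /GRing.scale/= mulr1.
  apply: lspan_gen; exists (fun=> 0%N), 1; split=> //.
    by rewrite big1.
  apply/funext => x; rewrite /GRing.scale/= mulr1.
  by rewrite big1// => l _; rewrite expr0.
- by move=> d; exact: lspan_zero.
- by move=> d f g _ ihf _ ihg; exact: lspan_add.
move=> d y f yP _.
apply: (lspan_ind _ (fun f => real_poly D d.+1 (fun x => y x * f x))).
- rewrite (_ : (fun _ => _) = (0 : D -> R)); first exact: lspan_zero.
  by apply/funext => x; rewrite mulr0.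
- move=> u v Pu Pv; rewrite (_ : (fun _ => _) =
    (fun x => y x * u x) + (fun x => y x * v x)); first exact: lspan_add.
  by apply/funext => x; rewrite mulrDr.
- move=> c v [al [c' [ald _ ->]]].
  rewrite (_ : (fun _ => _) =
    c *: (fun x => y x * (\prod_(l < n) val x l ord0 ^+ al l *: c'))); last first.
    by apply/funext => x; rewrite [RHS]mulrCA.
  apply: lspan_gen; case: yP => [->|[l0 ->]].
    exists al, c'; split=> //; first by rewrite (le_trans ald)// lez_nat.
    by apply/funext => x; rewrite mul1r.
  exists (fun l => al l + (l == l0))%N, c'; split=> //.
    by rewrite big_split/= sum_nat_delta addn1 lez_nat ltnS -lez_nat.
  apply/funext => x; rewrite [LHS]mulrA; congr (_ * _).
  rewrite (bigD1 l0)//= [RHS](bigD1 l0)//= eqxx addn1 exprS -mulrA.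
  by congr (_ * (_ * _)); apply: eq_bigr => l /negPf ->; rewrite addn0.
Qed.

End polynomials_as_forms.

Section barycentric_monomials.
Context {R : realType} {n : nat} (a : 'I_n.+1 -> 'cV[R]_n).
Context (D : set 'cV[R]_n) (h : seq (option 'I_n.+1)).

Definition lam_gens : set (D -> R) :=
  [set y | exists2 l, l \notin h & y = fun x : D => lam a l (val x)].

Lemma bary_mono_form d (al : multi_index d) :
  hat_exps h al -> form lam_gens d (bary_mono a D al).
Proof.
move=> /andP[/eqP ald /allP alh].
rewrite -[X in form _ X]ald.
apply: (form_monomial _ _ _ (fun l (x : D) => lam a l (val x))) => l al0.
apply: form_gen; exists l => //.
by apply: contra al0 => /alh.
Qed.

(** Multiplication by [lam l] shifts an exponent by one, so combinations of the
    monomials with exponents off [h] are stable under the rules defining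
    [form]. *)
Lemma bary_combP d (f : D -> R) :
  form lam_gens d f <-> exists c : multi_index d -> R, f = bary_comb a D h c.
Proof.
split; last first.
  move=> [c ->]; apply: form_sum => al hal; apply: form_scale.
  exact: bary_mono_form.
have comb_sum e (I : finType) (P : pred I) (F : I -> D -> R) (b : I -> R) :
    (forall i, P i -> exists c : multi_index e -> R, F i = bary_comb a D h c) ->
    exists c : multi_index e -> R,
      (fun x => \sum_(i | P i) b i * F i x) = bary_comb a D h c.
  move=> FE; have /choice[c cE] : forall i, exists c : multi_index e -> R,
      P i -> F i = bary_comb a D h c.
    by move=> i; case: (boolP (P i)) => [/FE[c ->]|_]; [exists c|exists (fun=> 0)].
  exists (fun al => \sum_(i | P i) b i * c i al).
  apply/funext => x; rewrite /bary_comb.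
  under [RHS]eq_bigr do rewrite mulr_suml.
  rewrite exchange_big/=; apply: eq_bigr => i Pi.
  by rewrite cE// mulr_sumr; apply: eq_bigr => al _; rewrite mulrA.
have comb_mono e (al : multi_index e) : hat_exps h al ->
    exists c : multi_index e -> R, bary_mono a D al = bary_comb a D h c.
  move=> hal; exists (fun be => (be == al)%:R); apply/funext => x.
  rewrite /bary_comb (bigD1 al)//= eqxx mul1r big1 ?addr0// => be /andP[_].
  by move=> /negPf ->; rewrite mul0r.
elim=> {d f}.
- move=> c; have /comb_mono[b bE] : hat_exps h ([ffun=> ord0] : multi_index 0).
    rewrite /hat_exps big1 => [|l _]; last by rewrite ffunE.
    by rewrite eqxx/=; apply/allP => l _; rewrite ffunE.
  have [|c' c'E] := comb_sum 0%N unit predT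
      (fun=> bary_mono a D ([ffun=> ord0] : multi_index 0)) (fun=> c).
    by move=> i _; exists b.
  exists c'; rewrite -c'E; apply/funext => x.
  rewrite big_const card_unit /= addr0 /bary_mono.
  by rewrite big1 ?mulr1// => l _; rewrite ffunE expr0.
- move=> d; exists (fun=> 0); apply/funext => x; rewrite /bary_comb big1// => al.
  by rewrite mul0r.
- move=> d f g _ [c ->] _ [c' ->]; exists (fun al => c al + c' al).
  apply/funext => x; rewrite /bary_comb -big_split/=.
  by apply: eq_bigr => al _; rewrite mulrDl.
move=> d y f [l lh ->] _ [c ->].
pose up (al : multi_index d) : multi_index d.+1 :=
  [ffun l' => inord (al l' + (l' == l))%N].
have upE al l' : up al l' = (al l' + (l' == l))%N :> nat.
  by rewrite ffunE inordK// ltnS -[X in (_ <= X)%N]addn1 leq_add ?leq_b1// -ltnS.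
have [|c' c'E] := comb_sum d.+1 (multi_index d) (hat_exps h)
    (fun al => bary_mono a D (up al)) c.
  move=> al /andP[/eqP ald /allP alh]; apply: comb_mono; apply/andP; split.
    under eq_bigr do rewrite upE.
    by rewrite big_split/= ald sum_nat_delta addn1.
  apply/allP => l' l'h; rewrite upE addn_eq0 alh//=.
  by move: lh; case: (eqVneq l' l) => // <-; rewrite l'h.
exists c'; rewrite -c'E; apply/funext => x; rewrite /bary_comb mulr_sumr.
apply: eq_bigr => al _; rewrite mulrCA; congr (_ * _).
rewrite /bary_mono (bigD1 l)//= [RHS](bigD1 l)//= upE eqxx addn1 exprS -mulrA.
by congr (_ * (_ * _)); apply: eq_bigr => l' /negPf l'l; rewrite upE l'l addn0.
Qed.

Lemma hat_polyP d (f : D -> R) : hat_poly a D d h f <-> form lam_gens d f.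
Proof.
rewrite bary_combP; apply: (iff_trans (lspan_fin _ _ _)).
by split=> -[c ->]; exists c; rewrite fct_sumE.
Qed.

End barycentric_monomials.

(** * Barycentric coordinates *)

Section barycentric.
Context {R : realType} {n : nat} (a : 'I_n.+1 -> 'cV[R]_n).
Hypothesis a_aff : affinely_independent a.

(** Row [i] is [(1, a_i)]; column [p] of the inverse holds the constant term and
    the gradient of the [p]-th barycentric coordinate. *)
Definition vertex_mx : 'M[R]_n.+1 :=
  \matrix_(i, j) if unlift ord0 j is Some l then a i l ord0 else 1.

Lemma vertex_mx0 i : vertex_mx i ord0 = 1.
Proof. by rewrite mxE unlift_none. Qed.

Lemma vertex_mxS i l : vertex_mx i (lift ord0 l) = a i l ord0.
Proof. by rewrite mxE liftK. Qed.

Lemma vertex_mx_unit : vertex_mx \in unitmx.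
Proof.
rewrite -row_free_unit -kermx_eq0; apply/rowV0P => u /sub_kermxP uM.
have u_ q : \sum_i u ord0 i * vertex_mx i q = 0.
  by move/matrixP: uM => /(_ ord0 q); rewrite !mxE.
apply/rowP => i; rewrite [RHS]mxE; apply: (a_aff (u ord0)).
  by rewrite -[RHS](u_ ord0); apply: eq_bigr => q _; rewrite vertex_mx0 mulr1.
apply/colP => l; rewrite [RHS]mxE -[RHS](u_ (lift ord0 l)) summxE.
by apply: eq_bigr => q _; rewrite vertex_mxS mxE.
Qed.

Definition bary_const (p : 'I_n.+1) : R := invmx vertex_mx ord0 p.

Definition bary_grad (p : 'I_n.+1) : 'cV[R]_n :=
  \col_l invmx vertex_mx (lift ord0 l) p.

Lemma bary_grad_vertex i p :
  bary_const p + \sum_l a i l ord0 * bary_grad p l ord0 = (i == p)%:R.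
Proof.
have /matrixP/(_ i p) := mulmxV vertex_mx_unit; rewrite !mxE => <-.
rewrite big_ord_recl vertex_mx0 mul1r; congr (_ + _).
by apply: eq_bigr => l _; rewrite vertex_mxS mxE.
Qed.

Lemma sum_bary_const : \sum_p bary_const p = 1.
Proof.
have /matrixP/(_ ord0 ord0) := mulVmx vertex_mx_unit; rewrite !mxE eqxx /= mulr1n => <-.
by apply: eq_bigr => p _; rewrite vertex_mx0 mulr1.
Qed.

Lemma sum_bary_grad : \sum_p bary_grad p = 0.
Proof.
apply/colP => l; rewrite summxE mxE.
have /matrixP/(_ (lift ord0 l) ord0) := mulVmx vertex_mx_unit.
rewrite !mxE /= mulr0n => H; rewrite -[RHS]H.
by apply: eq_bigr => p _; rewrite vertex_mx0 mulr1 mxE.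
Qed.

Lemma sum_bary_const_vertex : \sum_p bary_const p *: a p = 0.
Proof.
apply/colP => l; rewrite summxE mxE.
have /matrixP/(_ ord0 (lift ord0 l)) := mulVmx vertex_mx_unit.
rewrite !mxE /= mulr0n => H; rewrite -[RHS]H.
by apply: eq_bigr => p _; rewrite vertex_mxS mxE.
Qed.

Lemma sum_bary_grad_vertex l l' :
  \sum_p bary_grad p l ord0 * a p l' ord0 = (l == l')%:R.
Proof.
have /matrixP/(_ (lift ord0 l) (lift ord0 l')) := mulVmx vertex_mx_unit.
rewrite !mxE (inj_eq lift_inj) => <-.
by apply: eq_bigr => p _; rewrite vertex_mxS mxE.
Qed.

Lemma barycentric_unique (c : 'I_n.+1 -> R) :
  \sum_i c i = 1 -> barycentric a (\sum_i c i *: a i) = c.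
Proof.
move=> c1; rewrite /barycentric; case: xgetP => [b _ [b1 cb]|/(_ c)[]//].
suff bc i : b i - c i = 0 by apply/funext => i; apply: subr0_eq; exact: bc.
apply: (a_aff (fun i => b i - c i)) i.
  by rewrite sumrB b1 c1 subrr.
by under eq_bigr do rewrite scalerBl; rewrite sumrB cb subrr.
Qed.

Let aff (x : 'cV[R]_n) p := bary_const p + \sum_l x l ord0 * bary_grad p l ord0.

Let aff_sum x : \sum_i aff x i = 1.
Proof.
rewrite big_split/= sum_bary_const exchange_big/= big1 ?addr0// => l _.
by rewrite -mulr_sumr -summxE sum_bary_grad mxE mulr0.
Qed.

Let aff_point x : \sum_i aff x i *: a i = x.
Proof.
under eq_bigr do rewrite scalerDl.
rewrite big_split/= sum_bary_const_vertex add0r; apply/colP => l.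
rewrite summxE; under eq_bigr do rewrite mxE mulr_suml.
rewrite exchange_big/=; under eq_bigr => l' _.
  under eq_bigr do rewrite -mulrA.
  rewrite -mulr_sumr sum_bary_grad_vertex.
  over.
rewrite (bigD1 l)//= eqxx mulr1 big1 ?addr0// => l' /negPf ->.
by rewrite mulr0.
Qed.

(** The inverse of [vertex_mx] gives coordinates of [x] that sum to [1], and such
    coordinates are unique. *)
Lemma barycentricE x p :
  barycentric a x p = bary_const p + \sum_l x l ord0 * bary_grad p l ord0.
Proof. by rewrite -{1}(aff_point x) barycentric_unique// aff_sum. Qed.

Lemma barycentric_sum x : \sum_i barycentric a x i = 1.
Proof. by rewrite -(aff_sum x); apply: eq_bigr => i _; exact: barycentricE. Qed.

Lemma barycentric_point x : \sum_i barycentric a x i *: a i = x.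
Proof.
by rewrite -[RHS]aff_point; apply: eq_bigr => i _; rewrite barycentricE.
Qed.

Lemma hullP A x : hull a A x <->
  (forall i, 0 <= barycentric a x i) /\ (forall i, i \notin A -> barycentric a x i = 0).
Proof.
split=> [[c [c0 cA c1 ->]]|[x0 xA]]; first by rewrite barycentric_unique.
exists (barycentric a x); split=> //; first exact: barycentric_sum.
by rewrite barycentric_point.
Qed.

Lemma coord_genE (D : set 'cV[R]_n) (Y : set (D -> R)) :
  (forall l, form Y 1 (fun x : D => barycentric a (val x) l)) ->
  forall y, coord_gens D y -> form Y 1 y.
Proof.
move=> Yl y [->|[l ->]].
  apply: form_ext (form_sum Y 1 _ (index_enum _) predT _ (fun p _ => Yl p)) => x.
  exact: barycentric_sum.
apply: form_ext (form_sum Y 1 _ (index_enum _) predT _ (fun p _ =>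
  form_scale _ _ (a p l ord0) _ (Yl p))) => x.
rewrite /= -{2}(barycentric_point (val x)) summxE.
by apply: eq_bigr => p _; rewrite mxE mulrC.
Qed.

Lemma lam_coord_form (D : set 'cV[R]_n) l :
  form (coord_gens D) 1 (fun x : D => lam a l (val x)).
Proof.
case: l => [p|]; last exact: coord_gens_lower.
have Y1 : form (coord_gens D) 1 (fun x : D => \sum_l bary_grad p l ord0 * val x l ord0).
  by apply: form_sum => l _; apply: form_scale; apply: form_gen; right; exists l.
have := form_add _ _ _ _ (form_scale _ _ (bary_const p) _ (coord_gens_lower D)) Y1.
apply: form_ext => x; rewrite /= mulr1 barycentricE; congr (_ + _).
by apply: eq_bigr => l _; rewrite mulrC.
Qed.

(** Both [1] and the Cartesian coordinates are linear in the barycentric ones,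
    which are themselves affine functions. Hence it does not matter which of
    the [lam l] are left out as long as the others span all barycentric
    coordinates on [D]; on a face several choices of [h] do. *)
Lemma real_poly_lamP (D : set 'cV[R]_n) h d (f : D -> R) :
  (forall l, form (lam_gens a D h) 1 (fun x : D => barycentric a (val x) l)) ->
  real_poly D d%:Z f <-> form (lam_gens a D h) d f.
Proof.
move=> hD; rewrite real_polyP; split; first exact/form_change/coord_genE.
by apply: form_change => y [l _ ->]; exact: lam_coord_form.
Qed.

End barycentric.

(** * Integration over the standard simplex *)

Section standard_simplex.
Context {R : realType} {m : nat}.
Let T := measurableTypeR R.

(** Barycentric coordinates of the simplex spanned by [0] and the unit vectors;
    index [0] belongs to the vertex [0]. *)
Definition std_coord (l : 'I_m.+1) (s : m.-tuple T) : R :=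
  if unlift ord0 l is Some r then tnth s r else 1 - \sum_r (tnth s r : R).

Definition std_simplex : set (m.-tuple T) :=
  [set s | forall l, 0 <= std_coord l s].

Definition std_gens : set (m.-tuple T -> R) :=
  [set y | exists l, y = std_coord l].

Definition cube (u : 'I_m -> R) (d : R) : set (m.-tuple T) :=
  [set s | forall r, u r <= tnth s r <= u r + d].

Lemma std_coord0 s : std_coord ord0 s = 1 - \sum_r (tnth s r : R).
Proof. by rewrite /std_coord unlift_none. Qed.

Lemma std_coordS r s : std_coord (lift ord0 r) s = tnth s r.
Proof. by rewrite /std_coord liftK. Qed.

Lemma std_coord_sum s : \sum_l std_coord l s = 1.
Proof.
rewrite big_ord_recl std_coord0.
under [X in _ + X]eq_bigr do rewrite std_coordS.
by rewrite subrK.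
Qed.

Lemma std_coord_le1 l s : std_simplex s -> std_coord l s <= 1.
Proof.
by move=> s0; rewrite -(std_coord_sum s) (bigD1 l)//= lerDl sumr_ge0.
Qed.

Lemma measurable_std_coord l : measurable_fun setT (std_coord l).
Proof.
case: (unliftP ord0 l) => [r|] ->.
  rewrite (_ : std_coord _ = fun s => tnth s r); first exact: measurable_tnth.
  by apply/funext => s; rewrite std_coordS.
rewrite (_ : std_coord _ = fun s => 1 - \sum_r (tnth s r : R)); last first.
  by apply/funext => s; rewrite std_coord0.
apply: measurable_funB => //; apply: measurable_sum => r.
exact: measurable_tnth.
Qed.

Lemma measurable_form d h : form std_gens d h -> measurable_fun setT h.
Proof.
elim=> [c|e|e f g _ mf _ mg|e y f [l ->] _ mf].
- exact: measurable_cst.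
- exact: measurable_cst.
- exact: measurable_funD.
- by apply: measurable_funM => //; exact: measurable_std_coord.
Qed.

Lemma bounded_form d h : form std_gens d h ->
  exists M, forall s, std_simplex s -> `|h s| <= M.
Proof.
elim=> [c|e|e f g _ [M fM] _ [N gN]|e y f [l ->] _ [M fM]].
- by exists `|c|.
- by exists 0 => s _; rewrite normr0.
- exists (M + N) => s Ds; rewrite (le_trans (ler_normD _ _))//.
  by rewrite lerD ?fM ?gN.
- exists M => s Ds; rewrite normrM ger0_norm ?Ds//.
  rewrite (le_trans _ (fM _ Ds))// ler_piMl//.
  exact: std_coord_le1.
Qed.

(** Tuples carry the measure and row vectors the topology. *)
Lemma continuous_form d h : form std_gens d h ->
  continuous (fun v : 'rV[R]_m => h [tuple v ord0 r | r < m]).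
Proof.
elim=> [c|e|e f g _ cf _ cg|e y f [l ->] _ cf].
- exact: cst_continuous.
- exact: cst_continuous.
- by move=> v; apply: continuousD; [exact: cf|exact: cg].
- move=> v; apply: continuousM; last exact: cf.
  case: (unliftP ord0 l) => [r|] ->.
    rewrite (_ : (fun _ => _) = fun v : 'rV[R]_m => v ord0 r).
      exact: coord_continuous.
    by apply/funext => w; rewrite std_coordS tnth_mktuple.
  rewrite (_ : (fun _ => _) = fun v : 'rV[R]_m => 1 - \sum_r v ord0 r); last first.
    apply/funext => w; rewrite std_coord0; congr (_ - _).
    by apply: eq_bigr => r _; rewrite tnth_mktuple.
  apply: continuousB; first exact: cst_continuous.
  apply: (cvg_big _ (Ff := fun r (w : 'rV[R]_m) => w ord0 r)).
  - exact: add_continuous.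
  - exact: nbhs_filter.
  - by move=> r _; exact: coord_continuous.
Qed.

Lemma form_neq0_near d h s0 : form std_gens d h -> h s0 != 0 ->
  exists2 e : R, 0 < e &
    forall s, (forall r, `|(tnth s0 r : R) - tnth s r| < e) -> h s != 0.
Proof.
move=> hf h0; pose v0 : 'rV[R]_m := \row_r tnth s0 r.
have h0v : h [tuple v0 ord0 r | r < m] != 0.
  rewrite (_ : [tuple _ | _ < _] = s0)//; apply: eq_from_tnth => r.
  by rewrite tnth_mktuple mxE.
have : \forall v \near v0, h [tuple (v : 'rV[R]_m) ord0 r | r < m] != 0.
  apply: (continuous_form _ _ hf v0 [set y | y != 0]).
  by apply: open_nbhs_nbhs; split; [exact: open_neq|exact: h0v].
move=> /nbhs_ballP[e /= e0 eP]; exists e => // s se.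
have := eP (\row_r tnth s r).
rewrite (_ : [tuple _ | _ < _] = s); last first.
  by apply: eq_from_tnth => r; rewrite tnth_mktuple mxE.
apply; split=> // i r; rewrite !mxE.
exact: se.
Qed.

Lemma measurable_std_simplex : measurable std_simplex.
Proof.
rewrite (_ : std_simplex = \bigcap_l (std_coord l @^-1` `[0, +oo[%classic)).
  apply: fin_bigcap_measurable => [|l _]; first exact: finite_finset.
  rewrite -[X in measurable X]setTI.
  exact: measurable_std_coord.
apply/seteqP; split=> s /= sP.
  by move=> l _ /=; rewrite in_itv/= andbT.
by move=> l; have := sP l I; rewrite /= in_itv/= andbT.
Qed.

Lemma measurable_cube u d : measurable (cube u d).
Proof.
rewrite (_ : cube u d =
    \bigcap_r ((fun s : m.-tuple T => tnth s r) @^-1` `[u r, u r + d]%classic)).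
  apply: fin_bigcap_measurable => [|r _]; first exact: finite_finset.
  rewrite -[X in measurable X]setTI.
  exact: measurable_tnth.
apply/seteqP; split=> s /= sP; first by move=> r _ /=; rewrite in_itv/=.
by move=> r; have := sP r I; rewrite /= in_itv.
Qed.

End standard_simplex.

Lemma lebesgue_cube {R : realType} m (u : 'I_m -> R) d : 0 <= d ->
  lebesgue_tuple m (cube u d) = (d ^+ m)%:E.
Proof.
move=> d0; elim: m u => [|m ih] u /=.
  by rewrite diracE mem_set// => -[].
rewrite /lebesgue_cons /pushforward (_ : _ @^-1` _ =
  `[u ord0, u ord0 + d]%classic `*` cube (fun r => u (lift ord0 r)) d).
  rewrite product_measure1E//; last exact: measurable_cube.
  rewrite ih exprS EFinM; congr (_ * _)%E.
  apply: etrans (lebesgue_measure_itv _) _; rewrite /= lte_fin ltrDl.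
  case: ltgtP d0 => // [_|<-] _ //.
  by rewrite -EFinB addrC addKr.
apply/seteqP; split=> [[x t] /= xt|[x t] /= [x0 tP] r].
  split=> [|r]; first by have := xt ord0; rewrite in_itv (tnth_nth x).
  by have := xt (lift ord0 r); rewrite tnthS.
case: (unliftP ord0 r) => [r'|] ->; first by rewrite tnthS; exact: tP.
by rewrite (tnth_nth x).
Qed.

Section standard_simplex_integral.
Context {R : realType} {m : nat}.
Let T := measurableTypeR R.
Let mu := @lebesgue_tuple R m.

Lemma std_simplex_finite : (mu std_simplex < +oo)%E.
Proof.
apply: (@le_lt_trans _ _ (mu (cube (fun=> 0) 1))); last first.
  by rewrite lebesgue_cube// ltry.
apply: le_measure; rewrite ?inE.
- exact: measurable_std_simplex.
- exact: measurable_cube.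
move=> s Ds r; rewrite -std_coordS add0r Ds/=.
exact: std_coord_le1.
Qed.

Lemma integrable_form d (h : m.-tuple T -> R) :
  form std_gens d h -> mu.-integrable std_simplex (EFin \o h).
Proof.
move=> hf; apply: measurable_bounded_integrable.
- exact: measurable_std_simplex.
- exact: std_simplex_finite.
- by apply: measurable_funTS; exact: measurable_form hf.
have [M hM] := bounded_form _ _ hf; exists M; split=> [|N MN s Ds].
  exact: num_real.
exact: le_trans (hM _ Ds) (ltW MN).
Qed.

(** Every point of the simplex, boundary points included, is close to a small
    cube in the interior, which has positive measure. *)
Lemma std_simplex_cube (s0 : m.-tuple T) (e : R) : std_simplex s0 -> 0 < e ->
  exists u d, 0 < d /\ forall s, cube u d s ->
    (forall l, 0 < std_coord l s) /\
    (forall r, `|(tnth s0 r : R) - tnth s r| < e).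
Proof.
move=> Ds0 e0; pose t : R := Num.min (e / 3) (1 / 2).
have t0 : 0 < t by rewrite lt_min !divr_gt0.
have te : t < e / 2.
  by apply: (@le_lt_trans _ _ (e / 3)); [by rewrite ge_min lexx|lra].
have t1 : t < 1 by apply: (@le_lt_trans _ _ (1 / 2)); [by rewrite ge_min lexx orbT|lra].
have m0 : 0 < 2 * m.+1%:R :> R by rewrite mulr_gt0.
pose d : R := t / (2 * m.+1%:R).
have d0 : 0 < d by rewrite divr_gt0.
have dE : 2 * (m%:R * d + d) = t.
  by rewrite -[X in _ + X]mul1r -mulrDl natr1 mulrA mulrC divfK// gt_eqF.
have md0 : 0 <= m%:R * d by rewrite mulr_ge0// ltW.
clearbody d t.
(* Shrinking [s0] towards the vertex [0] by [1 - t] frees the amount [t] in the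
   coordinate [0]; the cube and its offset from the walls use less than [t]. *)
exists (fun r => (1 - t) * tnth s0 r + d), d; split=> // s sC.
have s0r r : 0 <= tnth s0 r :> R by rewrite -std_coordS.
split=> [l|r].
  case: (unliftP ord0 l) => [r|] ->.
    rewrite std_coordS; have /andP[+ _] := sC r; apply: lt_le_trans.
    by rewrite ltr_wpDl// mulr_ge0// subr_ge0 ltW.
  rewrite std_coord0 subr_gt0.
  apply: (@le_lt_trans _ _ (\sum_r ((1 - t) * (tnth s0 r : R) + d + d))).
    by apply: ler_sum => r _; have /andP[_] := sC r.
  rewrite !big_split/= -mulr_sumr !sumr_const card_ord -[d *+ m]mulr_natl.
  have : \sum_r (tnth s0 r : R) <= 1 by have := Ds0 ord0; rewrite std_coord0 subr_ge0.
  have t1' : 0 <= 1 - t by rewrite subr_ge0 ltW.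
  move=> /(ler_wpM2l t1'); rewrite mulr1; move: dE md0 d0.
  by move: (m%:R * d) ((1 - t) * _) => x y; lra.
have /andP[sl sr] := sC r.
have sr1 : tnth s0 r <= 1 :> R by rewrite -std_coordS; exact: std_coord_le1.
have : t * (tnth s0 r : R) <= t by rewrite ler_piMr// ltW.
have : 0 <= t * (tnth s0 r : R) by rewrite mulr_ge0// ltW.
move: sl sr; rewrite ltr_norml; set a := (tnth s0 r : R); set b := (tnth s r : R).
by move=> sl sr ta0 ta; apply/andP; split; lra.
Qed.

(** The integrand vanishes almost everywhere. If [h] were nonzero at a point, it
    would be nonzero on a cube in the interior, where [w] does not vanish
    either, and this cube would be a null set. *)
Lemma std_integral_definite d e (w h : m.-tuple T -> R) :
  form std_gens d w -> form std_gens e h ->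
  (forall s, (forall l, 0 < std_coord l s) -> w s != 0) ->
  (forall s, std_simplex s -> 0 <= w s * h s) ->
  \int[mu]_(s in std_simplex) (w s * h s) = 0 ->
  forall s, std_simplex s -> h s = 0.
Proof.
move=> wf hf w0 wh0 iwh s0 Ds0; apply/eqP/negPn/negP => h0.
have whf := form_mul _ _ _ _ _ wf hf.
have mwh : measurable_fun std_simplex (EFin \o (fun s => w s * h s)).
  by apply/measurable_EFinP; apply: measurable_funTS; exact: measurable_form whf.
have : (\int[mu]_(s in std_simplex) `|(w s * h s)%:E| = 0)%E.
  transitivity (\int[mu]_(s in std_simplex) (w s * h s)%:E)%E.
    apply: eq_integral => s; rewrite inE => Ds.
    by rewrite gee0_abs// lee_fin wh0.
  have := integrable_fin_num measurable_std_simplex (integrable_form _ _ whf).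
  by move=> /fineK <-; move: iwh; rewrite /Rintegral/= => ->.
move/(ae_eq_integral_abs _ measurable_std_simplex mwh).1 => -[N [mN N0 sN]].
have [eps eps0 hnear] := form_neq0_near _ _ _ hf h0.
have [u [dl [dl0 uP]]] := std_simplex_cube s0 eps Ds0 eps0.
have : (mu (cube u dl) <= mu N)%E.
  apply: le_measure; rewrite ?inE//; first exact: measurable_cube.
  move=> s /uP[s_gt0 snear]; apply: sN => /= ss.
  have := ss (fun l => ltW (s_gt0 l)) => -[] /eqP.
  by rewrite mulf_eq0 (negPf (w0 _ s_gt0)) (negPf (hnear _ snear)).
by rewrite N0 (lebesgue_cube _ _ _ (ltW dl0)) lee_fin leNgt exprn_gt0.
Qed.

End standard_simplex_integral.

(** * Gram matrices *)

Section linear_algebra.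

Lemma dotE {R : comNzRingType} {q} (u : 'cV[R]_q) :
  (u^T *m u) ord0 ord0 = \sum_i u i ord0 ^+ 2.
Proof. by rewrite !mxE; apply: eq_bigr => i _; rewrite mxE. Qed.

Lemma dot_ge0 {R : realDomainType} {q} (u : 'cV[R]_q) :
  0 <= (u^T *m u) ord0 ord0.
Proof. by rewrite dotE sumr_ge0// => i _; exact: sqr_ge0. Qed.

Lemma dot_eq0 {R : realDomainType} {q} (u : 'cV[R]_q) :
  (u^T *m u) ord0 ord0 = 0 -> u = 0.
Proof.
rewrite dotE => /eqP; rewrite psumr_eq0 => [|i _]; last exact: sqr_ge0.
move=> /allP u0; apply/colP => i; rewrite mxE; apply/eqP.
by rewrite -sqrf_eq0; exact: u0 (mem_index_enum _).
Qed.

(** The matrices [t E^T E + (1 - t) I], [0 <= t <= 1], are positive definite, so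
    their determinant does not vanish along the segment that joins [I] to the
    Gram matrix. *)
Lemma det_gram_gt0 {R : rcfType} {p q} (E : 'M[R]_(p, q)) :
  (forall x : 'cV_q, E *m x = 0 -> x = 0) -> 0 < \det (E^T *m E).
Proof.
move=> E_inj; set G := E^T *m E.
pose P := \det ('X *: map_mx polyC G + (1 - 'X)%:M).
have PE t : P.[t] = \det (t *: G + (1 - t)%:M).
  rewrite -horner_evalE -det_map_mx; congr (\det _).
  apply/matrixP => i j; rewrite !mxE.
  rewrite /= !horner_evalE !hornerE hornerMn !hornerE.
  by [].
rewrite ltNge; apply/negP => G0.
have [||t /andP[t0 t1]] := @poly_ivt R (- P) 0 1 => //.
  rewrite !hornerN !PE scale0r add0r subr0 det1 scale1r subrr raddf0 addr0.
  by rewrite oppr_le0 ler01 oppr_ge0.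
rewrite rootN /root PE => /det0P[v v0 vG].
have Ev : t * ((E *m v^T)^T *m (E *m v^T)) ord0 ord0
    + (1 - t) * (v^T^T *m v^T) ord0 ord0 = 0.
  have vGv : t *: ((E *m v^T)^T *m (E *m v^T)) + (1 - t) *: (v^T^T *m v^T) = 0.
    rewrite -(mul0mx _ v^T) -vG mulmxDr mulmxDl -scalemxAr -scalemxAl.
    by rewrite mul_mx_scalar -scalemxAl trmx_mul !trmxK !mulmxA.
  move/matrixP: vGv => /(_ ord0 ord0).
  by rewrite mxE [X in X + _]mxE [X in _ + X]mxE [RHS]mxE.
have E0 := dot_ge0 (E *m v^T); have V0 := dot_ge0 v^T.
have {}Ev : t * ((E *m v^T)^T *m (E *m v^T)) ord0 ord0 = 0 /\
    (1 - t) * (v^T^T *m v^T) ord0 ord0 = 0.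
  have /eqP := Ev; rewrite paddr_eq0 ?mulr_ge0// ?subr_ge0//.
  by move=> /andP[/eqP-> /eqP->].
suff : v^T = 0.
  by move/(congr1 trmx); rewrite trmxK trmx0 => v_eq0; rewrite v_eq0 eqxx in v0.
have [t_eq1|t_neq1] := eqVneq t 1.
  by apply: E_inj; apply: dot_eq0; case: Ev; rewrite t_eq1 mul1r.
apply: dot_eq0; case: Ev => _ /eqP; rewrite mulf_eq0 subr_eq0 eq_sym.
by rewrite (negPf t_neq1) => /eqP.
Qed.

(** Solvability criterion for [c *m G = b] that does not ask for [G] to be
    invertible: it suits the Gram matrix of a spanning family. *)
Lemma gram_solvable {F : fieldType} {N} (G : 'M[F]_N) (b : 'rV[F]_N) :
  (forall x : 'cV_N, G *m x = 0 -> b *m x = 0) -> exists c : 'rV_N, c *m G = b.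
Proof.
move=> Gb; suff /submxP[c ->] : (b <= G)%MS by exists c.
rewrite submxE; apply/eqP/rowP => k; rewrite [RHS]mxE.
have /Gb : G *m col k (cokermx G) = 0.
  by rewrite colE mulmxA mulmx_coker mul0mx.
by rewrite colE mulmxA -colE => /colP/(_ ord0); rewrite mxE [RHS]mxE.
Qed.

End linear_algebra.

(** * The edge matrices form a basis of the symmetric matrices *)

Section edge_matrices.
Context {R : realType} {n : nat} (a : 'I_n.+1 -> 'cV[R]_n).
Hypothesis a_aff : affinely_independent a.

(** For [p < q] these functionals form, up to scaling, the basis dual to the edge
    matrices. *)
Definition grad_form (p q : 'I_n.+1) (A : 'M[R]_n) : R :=
  ((bary_grad a p)^T *m A *m bary_grad a q) ord0 ord0.

Definition edge_mx_of (e : edge_index n) : 'M[R]_n :=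
  edge_mx a (val e).1 (val e).2.

Lemma grad_edge p i j :
  ((bary_grad a p)^T *m (a j - a i)) ord0 ord0 = (j == p)%:R - (i == p)%:R.
Proof.
rewrite -!(bary_grad_vertex a a_aff) mxE opprD addrACA subrr add0r -sumrB.
by apply: eq_bigr => l _; rewrite !mxE mulrBr !(mulrC (a _ _ _)).
Qed.

Lemma edge_norm_neq0 i j : i != j -> enorm (a j - a i) != 0.
Proof.
move=> ij; apply/negP => /eqP; rewrite /enorm => /eqP.
rewrite sqrtr_eq0 -dotE => d0.
have /dot_eq0 aji : ((a j - a i)^T *m (a j - a i)) ord0 ord0 = 0.
  by apply/eqP; rewrite eq_le d0 dot_ge0.
have := grad_edge j i j; rewrite aji mulmx0 mxE eqxx (negPf ij) subr0.
by move/eqP; rewrite eq_sym oner_eq0.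
Qed.

Lemma grad_form_linear p q : linear (grad_form p q : 'M[R]_n -> R^o).
Proof.
move=> c A B; rewrite /grad_form mulmxDr mulmxDl -scalemxAr -scalemxAl.
by rewrite mxE [in LHS]mxE.
Qed.

HB.instance Definition _ p q :=
  GRing.isLinear.Build R 'M[R]_n R^o *:%R (grad_form p q) (grad_form_linear p q).

Lemma grad_form_edge p q i j : grad_form p q (edge_mx a i j) =
  (enorm (a j - a i) ^- 2) *
  (((j == p)%:R - (i == p)%:R) * ((j == q)%:R - (i == q)%:R)).
Proof.
rewrite /grad_form /edge_mx /edge_dir -!grad_edge.
set v := a j - a i; set s := (enorm v)^-1.
have -> : (bary_grad a p)^T *m (s *: v *m (s *: v)^T) *m bary_grad a q =
    s ^+ 2 *: (((bary_grad a p)^T *m v) *m ((bary_grad a q)^T *m v)^T).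
  rewrite linearZ/= !(=^~ scalemxAl, =^~ scalemxAr) scalerA.
  by rewrite trmx_mul trmxK !mulmxA expr2.
by rewrite mxE exprVn mxE big_ord1 [X in _ * (_ * X)]mxE.
Qed.

(** [g_p^T (a_j - a_i)] vanishes unless [p] is an endpoint of the edge, so only
    the edge with endpoints [p] and [q] contributes. *)
Lemma grad_form_edges (c : edge_index n -> R) (e : edge_index n) :
  grad_form (val e).1 (val e).2 (\sum_e' c e' *: edge_mx_of e') =
  - (enorm (a (val e).2 - a (val e).1) ^- 2 * c e).
Proof.
have ltF (i j : 'I_n.+1) : (i < j)%N -> (i == j) = false.
  by move=> ij; apply/negbTE; apply: contraTneq ij => ->; rewrite ltnn.
rewrite linear_sum (bigD1 e)//= big1 ?addr0.
  rewrite linearZ/= grad_form_edge; case: e => [[i j] /= ij].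
  rewrite !eqxx (ltF _ _ ij) eq_sym (ltF _ _ ij).
  by rewrite sub0r subr0 mulr1 mulrN1 scalerN [_ *: _]mulrC.
move=> [[i j] /= ij] ne; rewrite linearZ/= grad_form_edge.
case: e ne => [[p q] /= pq] ne.
suff -> : ((j == p)%:R - (i == p)%:R) * ((j == q)%:R - (i == q)%:R) = 0 :> R.
  by rewrite mulr0 scaler0.
have [jp|jp] := eqVneq j p; have [ip|ip] := eqVneq i p.
- by rewrite subrr mul0r.
- have [jq|jq] := eqVneq j q; have [iq|iq] := eqVneq i q.
  + by rewrite subrr mulr0.
  + by move: (pq); rewrite -jp jq ltnn.
  + by move: (pq); rewrite -jp -iq ltnNge (ltnW ij).
  + by rewrite subrr mulr0.
- have [jq|jq] := eqVneq j q; have [iq|iq] := eqVneq i q.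
  + by rewrite subrr mulr0.
  + by move/eqP: ne => []; apply: val_inj; rewrite /= ip jq.
  + by move: (pq); rewrite -ip iq ltnn.
  + by rewrite subrr mulr0.
- by rewrite subrr mul0r.
Qed.

(** The gradients sum to [0], so the vanishing of the off-diagonal values of the
    bilinear form of [A] forces that of the diagonal ones; and the gradients
    span, since [\sum_p a_p g_p^T = I]. *)
Lemma sym_grad_form_inj (A : 'M[R]_n) : A^T = A ->
  (forall e : edge_index n, grad_form (val e).1 (val e).2 A = 0) -> A = 0.
Proof.
move=> AT A0.
have GC p q : grad_form q p A = grad_form p q A.
  rewrite /grad_form.
  transitivity (((bary_grad a p)^T *m A *m bary_grad a q)^T ord0 ord0).
    by rewrite !trmx_mul trmxK AT mulmxA.
  by rewrite mxE.
have Glt (p q : 'I_n.+1) : (p < q)%N -> grad_form p q A = 0.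
  by move=> pq; exact: (A0 (exist _ (p, q) pq)).
have Gne p q : p != q -> grad_form p q A = 0.
  by rewrite neq_ltn => /orP[/Glt//|/Glt]; rewrite GC.
have G0 p q : grad_form p q A = 0.
  have [<-|/Gne//] := eqVneq p q.
  have : \sum_r grad_form p r A = 0.
    rewrite /grad_form -summxE -mulmx_sumr sum_bary_grad ?mulmx0 ?mxE//.
  by rewrite (bigD1 p)//= big1 ?addr0// => r /eqP/nesym/eqP/Gne.
have IE : \sum_p a p *m (bary_grad a p)^T = 1%:M.
  apply/matrixP => l l'; rewrite summxE mxE eq_sym.
  rewrite -(sum_bary_grad_vertex a a_aff); apply: eq_bigr => p _.
  by rewrite mxE big_ord1 mxE mulrC.
rewrite -[A]mul1mx -[1%:M *m A]mulmx1 -{1}IE -trmx1 -IE linear_sum/=.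
rewrite mulmx_suml mulmx_suml big1// => p _.
rewrite mulmx_sumr big1// => q _.
rewrite trmx_mul trmxK !mulmxA -(mulmxA (a p)) -(mulmxA (a p)).
rewrite [X in a p *m X](_ : _ = 0) ?mulmx0 ?mul0mx//.
by apply/matrixP => i j; rewrite !ord1 [RHS]mxE; exact: G0.
Qed.

End edge_matrices.

(** * Polynomials and integration on a face *)

Lemma form_finite_span {R : realType} {n : nat} (a : 'I_n.+1 -> 'cV[R]_n)
    (D : set 'cV[R]_n) h d :
  exists N (M : 'I_N -> D -> R), (forall t, form (lam_gens a D h) d (M t)) /\
    forall f, form (lam_gens a D h) d f ->
      exists c : 'I_N -> R, f = fun x => \sum_t c t * M t x.
Proof.
exists #|[pred al : multi_index d | hat_exps h al]|.
exists (fun t => bary_mono a D (enum_val t)); split.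
  by move=> t; apply: bary_mono_form; have := enum_valP t.
move=> f /bary_combP[c ->]; exists (fun t => c (enum_val t)).
apply/funext => x; rewrite /bary_comb.
exact: (@big_enum_val _ _ _ _ [pred al | hat_exps h al]
  (fun al => c al * bary_mono a D al x)).
Qed.

Definition point_of {U : Type} {A : set U} {x : U} (Ax : A x) : A :=
  exist (fun u => u \in A) x (mem_set Ax).

Section extension_by_zero.
Context {R : realType} {U : Type} {A : set U}.
Implicit Types p q : A -> R.

Lemma valL_val p (x : A) : 'valL_0 p (val x) = p x.
Proof. by rewrite /valL_/= oinv_set_val valK. Qed.

Lemma valL_mul p q u :
  'valL_0 p u * 'valL_0 q u = 'valL_0 (fun x => p x * q x) u.
Proof. by rewrite /valL_/=; case: ('oinv_set_val u) => //=; rewrite mulr0. Qed.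

End extension_by_zero.

Section face.
Context {R : realType} {m : nat} (a : 'I_m.+2 -> 'cV[R]_m.+1).
Hypothesis a_aff : affinely_independent a.
Variable j : 'I_m.+2.

Lemma face_vertexE (l : 'I_m.+1) : (face_vertices a j)`_l = a (lift j l).
Proof.
by rewrite (nth_map l) ?size_enum_ord// nth_ord_enum.
Qed.

Lemma face_chartE s :
  face_chart a j s = \sum_l std_coord l s *: a (lift j l).
Proof.
rewrite big_ord_recl std_coord0 /face_chart (face_vertexE ord0).
apply/colP => r; rewrite !mxE summxE mulrBl mul1r -addrA; congr (_ + _).
rewrite addrC mulr_suml -sumrB; apply: eq_bigr => l _.
by rewrite !mxE std_coordS (face_vertexE ord0) (face_vertexE (lift ord0 l)); ring.
Qed.

Lemma barycentric_face_chart s :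
  barycentric a (face_chart a j s) j = 0 /\
  forall l, barycentric a (face_chart a j s) (lift j l) = std_coord l s.
Proof.
pose c (i : 'I_m.+2) := if unlift j i is Some l then std_coord l s else 0.
have sum_c (V : nmodType) (F : 'I_m.+2 -> V) :
    \sum_i F i = F j + \sum_l F (lift j l).
  rewrite (bigD1_ord j)//=.
have cE : face_chart a j s = \sum_i c i *: a i.
  rewrite sum_c face_chartE {1}/c unlift_none scale0r add0r.
  by apply: eq_bigr => l _; rewrite /c liftK.
have c1 : \sum_i c i = 1.
  rewrite sum_c {1}/c unlift_none add0r -(std_coord_sum s).
  by apply: eq_bigr => l _; rewrite /c liftK.
rewrite cE (barycentric_unique a a_aff)// /c unlift_none; split=> // l.
by rewrite liftK.
Qed.

(** The chart carries the barycentric coordinates of the standard simplex to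
    those of the face. *)
Lemma face_chart_preimage : face_chart a j @^-1` face a j = std_simplex.
Proof.
apply/seteqP; split=> s /=; have [sj sl] := barycentric_face_chart s.
  by move=> /(hullP a a_aff)[s0 _] l; rewrite -sl.
move=> s0; apply/(hullP a a_aff); split=> i; last first.
  by rewrite inE negbK => /eqP ->.
by case: (unliftP j i) => [l|] ->; rewrite ?sj// sl.
Qed.

Lemma face_chart_in s : std_simplex s -> face a j (face_chart a j s).
Proof. by move=> Ds; rewrite -face_chart_preimage in Ds. Qed.

(** All polynomials on the face: the generator [lam None = 1] is included. *)
Definition face_form := form (lam_gens a (face a j) [::]).

Lemma face_form_sub h d p : form (lam_gens a (face a j) h) d p -> face_form d p.
Proof.
by apply: form_change => y [l _ ->]; apply: form_gen; exists l.
Qed.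

(** In the chart, a polynomial on the face agrees on the standard simplex with a
    polynomial defined everywhere, to which measurability and continuity
    apply. *)
Lemma face_form_pull d p : face_form d p -> exists2 h,
  form std_gens d h & forall s, std_simplex s -> 'valL_0 p (face_chart a j s) = h s.
Proof.
move=> pf; have [h hf hp] : exists2 h, form std_gens d h &
    forall s (x : face a j), val x = face_chart a j s -> h s = p x.
  apply: (form_transfer _ std_gens (fun s (x : face a j) => val x = face_chart a j s)) pf.
  move=> y [l _ ->].
  have gl r : form std_gens 1 (std_coord r : m.-tuple _ -> R).
    by apply: form_gen; exists r.
  case: l => [i|]; last first.
    exists (fun s => \sum_r std_coord r s); first exact: form_sum.
    by move=> s x _; rewrite std_coord_sum.
  case: (unliftP j i) => [l|] ->.
    exists (std_coord l) => // s x xs /=.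
    by rewrite xs (barycentric_face_chart s).2.
  exists (fun=> 0); first exact: form_zero.
  by move=> s x xs /=; rewrite xs (barycentric_face_chart s).1.
exists h => // s Ds; have fs := face_chart_in _ Ds.
pose x : face a j := point_of fs.
by rewrite (hp s x)// -(valL_val p x).
Qed.

Definition face_int (p : face a j -> R) : R := face_integral a j ('valL_0 p).

Lemma face_dotE p q : face_dot a p q = face_int (fun x => p x * q x).
Proof.
by congr (face_integral a j _); apply/funext => x; exact: valL_mul.
Qed.

Lemma face_edges_inj (x : 'cV[R]_m) : face_edges a j *m x = 0 -> x = 0.
Proof.
move=> Ex; pose c (i : 'I_m.+2) : R :=
  if unlift j i is Some l then
    if unlift ord0 l is Some r then x r ord0 else - \sum_r x r ord0
  else 0.
have cE : c j = 0 by rewrite /c unlift_none.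
have cE0 : c (lift j ord0) = - \sum_r x r ord0.
  by rewrite /c liftK unlift_none.
have cES r : c (lift j (lift ord0 r)) = x r ord0 by rewrite /c !liftK.
have sum_c (V : nmodType) (F : 'I_m.+2 -> V) :
    \sum_i F i = F j + (F (lift j ord0) + \sum_r F (lift j (lift ord0 r))).
  by rewrite (bigD1_ord j)//= big_ord_recl.
apply/colP => r; rewrite mxE -cES; apply: (a_aff c).
  by rewrite sum_c cE cE0 add0r addrC; under eq_bigr do rewrite cES; rewrite subrr.
rewrite sum_c cE cE0 scale0r add0r scaleNr scaler_suml addrC -sumrB.
under eq_bigr do rewrite cES -scalerBr.
rewrite -[RHS]Ex; apply/colP => i; rewrite summxE mxE; apply: eq_bigr => l _.
by rewrite !mxE (face_vertexE ord0) (face_vertexE (lift ord0 l)) mulrC.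
Qed.

Let gram := Num.sqrt (\det ((face_edges a j)^T *m face_edges a j)).

Let gram_gt0 : 0 < gram.
Proof. by rewrite sqrtr_gt0; apply: det_gram_gt0; exact: face_edges_inj. Qed.

Let face_intE p h : (forall s, std_simplex s -> 'valL_0 p (face_chart a j s) = h s) ->
  face_int p = gram * \int[lebesgue_tuple m]_(s in std_simplex) h s.
Proof.
move=> ph; rewrite /face_int /face_integral; congr (_ * _).
rewrite face_chart_preimage; apply: eq_Rintegral => s.
by rewrite inE => /ph.
Qed.

Lemma face_int_lin d e p q c : face_form d p -> face_form e q ->
  face_int (fun x => p x + c * q x) = face_int p + c * face_int q.
Proof.
move=> /face_form_pull[h hf hp] /face_form_pull[g gf gq].
rewrite (face_intE _ _ hp) (face_intE _ _ gq).
rewrite (face_intE _ (fun s => h s + c * g s)).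
  have mS := @measurable_std_simplex R m.
  have hi := integrable_form _ _ hf; have gi := integrable_form _ _ gf.
  have cgi := integrable_form _ _ (form_scale _ _ c _ gf).
  by rewrite RintegralD// RintegralZl// mulrDr mulrCA.
move=> s Ds; rewrite -hp// -gq//.
have fs := face_chart_in _ Ds.
by rewrite -[face_chart a j s]/(val (point_of fs)) !valL_val.
Qed.

Lemma face_int0 : face_int (fun=> 0) = 0.
Proof.
have H := face_int_lin 0 0 _ _ (- 1) (form_zero _ _) (form_zero _ _).
transitivity (face_int (fun=> 0) + (- 1) * face_int (fun=> 0)).
  by rewrite -H; congr face_int; apply/funext => x; rewrite mulr0 addr0.
by rewrite mulN1r subrr.
Qed.

Lemma face_int_sum {I : Type} (r : seq I) d (c : I -> R) (F : I -> face a j -> R) :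
  (forall i, face_form d (F i)) ->
  face_int (fun x => \sum_(i <- r) c i * F i x) = \sum_(i <- r) c i * face_int (F i).
Proof.
move=> FF; elim: r => [|i r ih].
  rewrite big_nil -[RHS]face_int0; congr face_int.
  by apply/funext => x; rewrite big_nil.
have sf : face_form d (fun x => \sum_(i <- r) c i * F i x).
  by apply: form_sum => l _; apply: form_scale; exact: FF.
rewrite big_cons -ih addrC -(face_int_lin _ _ _ _ _ sf (FF i)).
by congr face_int; apply/funext => x; rewrite big_cons addrC.
Qed.

(** The weight [lambda_i] is positive in the interior of the face, and every
    point of the face is in the image of the chart. *)
Lemma face_int_definite d i q : i != j -> face_form d q ->
  face_int (fun x => lam a (Some i) (val x) * (q x * q x)) = 0 ->
  q = fun=> 0.
Proof.
move=> ij qf; have [l il] : exists l, i = lift j l.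
  by case: (unliftP j i) ij => [l ->|->]; [exists l|rewrite eqxx].
have [h hf hq] := face_form_pull _ _ qf.
have lamE s : lam a (Some i) (face_chart a j s) = std_coord l s.
  by rewrite il /= (barycentric_face_chart s).2.
have fs := face_chart_in.
rewrite (face_intE _ (fun s => std_coord l s * (h s * h s))); last first.
  move=> s Ds; rewrite -hq// -lamE.
  by rewrite -[face_chart a j s]/(val (point_of (fs s Ds))) !valL_val.
move=> /eqP; rewrite mulf_eq0 gt_eqF//= => /eqP int0.
have hh0 : forall s, std_simplex s -> h s * h s = 0.
  apply: (std_integral_definite _ _ _ _ _ (form_mul _ _ _ _ _ hf hf) _ _ int0).
  - by apply: form_gen; exists l.
  - by move=> s sl; rewrite gt_eqF.
  - by move=> s Ds; rewrite mulr_ge0// -expr2 sqr_ge0.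
apply/funext => x.
pose s := [tuple barycentric a (val x) (lift j (lift ord0 r)) | r < m].
have [/= x0 xj] := (hullP a a_aff _ _).1 (set_mem (valP x)).
have sE r : std_coord r s = barycentric a (val x) (lift j r).
  case: (unliftP ord0 r) => [r'|] ->; first by rewrite std_coordS tnth_mktuple.
  rewrite std_coord0; under eq_bigr do rewrite tnth_mktuple.
  rewrite -(barycentric_sum a a_aff (val x)) (bigD1_ord j)//= big_ord_recl.
  by rewrite xj ?inE ?eqxx// add0r addrK.
have Ds : std_simplex s by move=> r; rewrite sE.
have xs : face_chart a j s = val x.
  rewrite face_chartE -[RHS](barycentric_point a a_aff) (bigD1_ord j)//=.
  rewrite xj ?inE ?eqxx// scale0r add0r.
  by apply: eq_bigr => r _; rewrite sE.
have := hh0 s Ds; rewrite -hq// xs valL_val => /eqP.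
by rewrite mulf_eq0 orbb => /eqP.
Qed.

(** The Gram matrix [G] of a spanning family of degree [k] for the inner product
    [\int lambda_i q r] need not be invertible. But a vector in its kernel
    represents a polynomial [f] with [\int lambda_i f^2 = 0], hence [f = 0], so
    the kernel also annihilates the right-hand side [\int g r]. *)
Lemma face_int_riesz i k h e g : i != j -> face_form e g ->
  exists2 q, form (lam_gens a (face a j) h) k q &
    forall r, form (lam_gens a (face a j) h) k r ->
      face_int (fun x => (g x - lam a (Some i) (val x) * q x) * r x) = 0.
Proof.
move=> ij gf.
have [N [M [Mf Mspan]]] := form_finite_span a (face a j) h k.
have Mff t : face_form k (M t) by exact: face_form_sub (Mf t).
pose w (x : face a j) := lam a (Some i) (val x).
have wf : face_form 1 w by apply: form_gen; exists (Some i).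
pose G : 'M[R]_N := \matrix_(s, t) face_int (fun x => w x * M s x * M t x).
pose b : 'rV[R]_N := \row_t face_int (fun x => g x * M t x).
have wMM s t : face_form (1 + k + k) (fun x => w x * M s x * M t x).
  exact: form_mul _ (1 + k)%N k _ _ (form_mul _ 1%N k _ _ wf (Mff s)) (Mff t).
have gM t : face_form (e + k) (fun x => g x * M t x).
  exact: form_mul _ e k _ _ gf (Mff t).
have [|c cG] := gram_solvable G b.
  move=> y Gy; pose f (x : face a j) := \sum_t y t ord0 * M t x.
  have ff : face_form k f by apply: form_sum => t _; exact: form_scale (Mff t).
  suff f0 : f = fun=> 0.
    apply/colP => l; rewrite ord1 !mxE -[RHS]face_int0.
    under eq_bigr do rewrite mxE mulrC.
    rewrite -(face_int_sum _ _ _ _ gM); congr face_int; apply/funext => x.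
    transitivity (g x * f x); last by rewrite f0 mulr0.
    by rewrite mulr_sumr; apply: eq_bigr => t _; rewrite mulrCA.
  apply: (face_int_definite k i) => //.
  transitivity (\sum_s y s ord0 * (G *m y) s ord0); last first.
    by rewrite big1// => s _; rewrite Gy mxE mulr0.
  have Gs s : (G *m y) s ord0 =
      face_int (fun x => \sum_t y t ord0 * (w x * M s x * M t x)).
    rewrite mxE (face_int_sum _ _ _ _ (wMM s)); apply: eq_bigr => t _.
    by rewrite mxE mulrC.
  under [RHS]eq_bigr do rewrite Gs.
  rewrite -(face_int_sum _ (1 + k + k)%N); last first.
    by move=> s; apply: form_sum => t _; exact: form_scale (wMM s t).
  congr face_int; apply/funext => x.
  transitivity ((w x * \sum_s y s ord0 * M s x) * f x); first by rewrite -mulrA.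
  rewrite [w x * _]mulr_sumr mulr_suml; apply: eq_bigr => s _.
  rewrite /f !mulr_sumr.
  by apply: eq_bigr => t _; ring.
exists (fun x => \sum_s c ord0 s * M s x).
  by apply: form_sum => s _; exact: form_scale (Mf s).
move=> r /Mspan[z ->].
set q := fun x : face a j => \sum_s c ord0 s * M s x.
have qf : face_form k q by apply: form_sum => s _; exact: form_scale (Mff s).
have rM t : face_int (fun x => (g x - w x * q x) * M t x) = 0.
  transitivity (face_int (fun x => g x * M t x + (- 1) *
      (\sum_s c ord0 s * (w x * M s x * M t x)))).
    congr face_int; apply/funext => x.
    rewrite mulrBl mulN1r; congr (_ - _); rewrite /q mulr_sumr mulr_suml.
    by apply: eq_bigr => s _; ring.
  rewrite (face_int_lin (e + k)%N (1 + k + k)%N)//; last first.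
    by apply: form_sum => s _; exact: form_scale (wMM s t).
  rewrite (face_int_sum _ (1 + k + k)%N)// mulN1r.
  have /rowP/(_ t) := cG; rewrite !mxE => <-; apply/eqP; rewrite subr_eq0.
  by apply/eqP; apply: eq_bigr => s _; rewrite mxE.
have one : face_form 1 (fun=> 1) by apply: form_gen; exists None.
have gwq : face_form (e + (1 + k)) (fun x => g x - w x * q x).
  apply: form_sub; first exact: form_lower_le one (leq_addr _ _) gf.
  exact: form_lower_le one (leq_addl _ _) (form_mul _ 1%N k _ _ wf qf).
transitivity (\sum_t z t * face_int (fun x => (g x - w x * q x) * M t x)).
  rewrite -(face_int_sum _ (e + (1 + k) + k)%N).
    congr face_int; apply/funext => x; rewrite mulr_sumr.
    by apply: eq_bigr => t _; rewrite mulrCA.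
  by move=> t; exact: form_mul gwq (Mff t).
by rewrite big1// => t _; rewrite rM mulr0.
Qed.

End face.

(** * Forms on the simplex and its faces *)

Section homogeneous_on_hull.
Context {R : realType} {n : nat} (a : 'I_n.+1 -> 'cV[R]_n).
Hypothesis a_aff : affinely_independent a.
Implicit Types (A : {pred 'I_n.+1}) (l : 'I_n.+1).

(** A point off the vertex [a l] is projected from this vertex onto the opposite
    face; the coordinates other than [lambda_l] are thereby scaled by a common
    factor, and so is [f]. At the vertex these coordinates are all [0], and the
    degree of [f] is positive. *)
Lemma form_hull_eq0 A l h d (f : hull a A -> R) :
  None \in h -> Some l \in h -> form (lam_gens a (hull a A) h) d.+1 f ->
  (forall x : hull a A, barycentric a (val x) l = 0 -> f x = 0) ->
  forall x : hull a A, f x = 0.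
Proof.
move=> h0 hl hf f0 x; pose b := barycentric a (val x).
have [b0 bA] := (hullP a a_aff _ _).1 (set_mem (valP x)).
have b1 : \sum_i b i = 1 := barycentric_sum a a_aff (val x).
have sum_l : \sum_(i | i != l) b i = 1 - b l.
  by rewrite -b1 [in RHS](bigD1 l)//= addrAC subrr add0r.
have [mu0|mu0] := eqVneq (1 - b l) 0.
  rewrite (form_homogeneous _ _ _ 0 x x _ hf) ?exprS ?mul0r//.
  move=> y [[i|] ih ->]; last by rewrite h0 in ih.
  rewrite mul0r /=; move/eqP: sum_l; rewrite mu0 psumr_eq0 => [/allP H|//].
  have il : i != l by apply: contraNneq ih => ->.
  by have := H i (mem_index_enum i); rewrite il => /eqP.
pose c i := if i == l then 0 else b i / (1 - b l).
have c1 : \sum_i c i = 1.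
  rewrite (bigD1 l)//= /c eqxx add0r.
  under eq_bigr => i /negPf -> do [].
  by rewrite -mulr_suml sum_l divff.
have xc : hull a A (\sum_i c i *: a i).
  apply/(hullP a a_aff); rewrite (barycentric_unique a a_aff)//; split=> i.
    rewrite /c; case: ifP => // _; rewrite divr_ge0 ?b0//.
    by rewrite -sum_l sumr_ge0.
  by move=> iA; rewrite /c /b bA// mul0r if_same.
rewrite (form_homogeneous _ _ _ (1 - b l) x (point_of xc) _ hf).
  by rewrite f0 ?mulr0//= (barycentric_unique a a_aff)// /c eqxx.
move=> y [[i|] ih ->]; last by rewrite h0 in ih.
rewrite /= (barycentric_unique a a_aff)// /c ifN; last by apply: contraNneq ih => ->.
by rewrite mulrC divfK.
Qed.

Lemma real_poly_simplexP d (f : simplex a -> R) :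
  real_poly (simplex a) d%:Z f <-> form (lam_gens a (simplex a) [:: None]) d f.
Proof.
apply: (real_poly_lamP a a_aff) => l; apply: form_gen.
by exists (Some l).
Qed.

Lemma real_poly_lt0 (D : set 'cV[R]_n) (d : int) (f : D -> R) :
  d < 0 -> real_poly D d f -> f = fun=> 0.
Proof.
move=> d0; apply: (lspan_ind _ (fun f => f = fun=> 0)) => [//|u v -> ->|c v].
  by apply/funext => x; exact: addr0.
move=> [al [b [ald _ _]]].
by have := le_lt_trans ald d0; rewrite ltz_nat ltn0.
Qed.

Lemma form_degree0 {T : Type} (Y Z : set (T -> R)) f : form Y 0 f -> form Z 0 f.
Proof.
move De: 0%N => e Yf; elim: Yf De => // {e f}.
- by move=> c _; exact: form_cst.
- by move=> d <-; exact: form_zero.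
- by move=> d f g _ ihf _ ihg d0; apply: form_add; [exact: ihf|exact: ihg].
Qed.

Lemma lam_gens_split (D : set 'cV[R]_n) l h d f :
  form (lam_gens a D h) d.+1 f -> exists g g',
  [/\ form (lam_gens a D h) d g,
      form (lam_gens a D (Some l :: h)) d.+1 g' &
      f = fun x : D => lam a (Some l) (val x) * g x + g' x].
Proof.
apply: form_split => [y [l' l'h ->]|y [l' +] ->].
  have [->|l'l] := eqVneq l' (Some l); first by left.
  by right; exists l' => //; rewrite inE negb_or l'l.
by rewrite inE negb_or => /andP[_ l'h]; exists l'.
Qed.

Lemma simplex_split l k (f : simplex a -> R) :
  form (lam_gens a (simplex a) [:: None]) k f -> exists g g',
  [/\ real_poly (simplex a) (k%:Z - 1) g,
      form (lam_gens a (simplex a) [:: None; Some l]) k g' &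
      f = fun x => lam a (Some l) (val x) * g x + g' x].
Proof.
case: k => [|k] hf.
  exists (fun=> 0), f; split; first exact: lspan_zero.
    exact: form_degree0 hf.
  by apply/funext => x; rewrite mulr0 add0r.
have [g [g' [hg hg' ->]]] := lam_gens_split _ l _ _ _ hf.
exists g, g'; split=> //.
  by rewrite intS addrAC subrr add0r; exact/real_poly_simplexP.
apply: form_change hg' => y [l' l'h ->]; apply: form_gen; exists l' => //.
by move: l'h; rewrite !inE orbC.
Qed.

Lemma form_lam_mul l k (u : simplex a -> R) :
  real_poly (simplex a) (k%:Z - 1) u ->
  form (lam_gens a (simplex a) [:: None]) k
    (fun x : simplex a => lam a (Some l) (val x) * u x).
Proof.
case: k => [|k] hu.
  rewrite (real_poly_lt0 _ _ _ _ hu)//.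
  by apply: form_ext (form_zero _ _) => x; rewrite mulr0.
apply: (form_genM _ _ (fun x : simplex a => lam a (Some l) (val x))).
  by exists (Some l).
by apply/real_poly_simplexP; move: hu; rewrite intS addrAC subrr add0r.
Qed.

End homogeneous_on_hull.

(** * The scalar decomposition attached to an edge *)

Section edge.
Context {R : realType} {m : nat} (a : 'I_m.+2 -> 'cV[R]_m.+1).
Hypothesis a_aff : affinely_independent a.
Variables (i j : 'I_m.+2).
Hypothesis ij : i != j.
Local Notation K := (simplex a).
Local Notation F := (face a j).

Lemma face_lam0 (x : F) : barycentric a (val x) j = 0.
Proof.
have [_ xj] := (hullP a a_aff _ _).1 (set_mem (valP x)).
by rewrite xj ?inE ?eqxx.
Qed.

Lemma real_poly_faceP d (p : F -> R) :
  real_poly F d%:Z p <-> form (lam_gens a F [:: None; Some j]) d p.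
Proof.
apply: (real_poly_lamP a a_aff) => l; have [->|lj] := eqVneq l j.
  by apply: form_ext (form_zero _ _) => x; rewrite face_lam0.
by apply: form_gen; exists (Some l) => //; rewrite !inE.
Qed.

(** On the face, [lambda_i] is [1] minus the coordinates other than [lambda_i] and
    [lambda_j]. *)
Lemma real_poly_face_dehomP d (p : F -> R) :
  real_poly F d%:Z p <-> form (lam_gens a F [:: Some i; Some j]) d p.
Proof.
apply: (real_poly_lamP a a_aff) => l; have [->|lj] := eqVneq l j.
  by apply: form_ext (form_zero _ _) => x; rewrite face_lam0.
have gl l' : l' != i -> l' != j ->
    form (lam_gens a F [:: Some i; Some j]) 1 (fun x : F => barycentric a (val x) l').
  move=> l'i l'j; apply: form_gen; exists (Some l') => //.
  by rewrite !inE negb_or; apply/andP.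
have [->|/gl] := eqVneq l i; last exact.
have one : form (lam_gens a F [:: Some i; Some j]) 1 (fun=> 1).
  by apply: form_gen; exists None.
have sumf : form (lam_gens a F [:: Some i; Some j]) 1
    (fun x : F => \sum_(l' | (l' != i) && (l' != j)) barycentric a (val x) l').
  by apply: form_sum => l' /andP[]; exact: gl.
apply: form_ext (form_sub _ _ _ _ one sumf) => x.
rewrite -(barycentric_sum a a_aff (val x)) (bigD1 i)//= (bigD1 j) 1?eq_sym//=.
by rewrite face_lam0 add0r addrK.
Qed.

(** The projection of the simplex onto [F] along the edge, which moves the
    barycentric weight of [a j] to [a i]. *)
Definition slide_pt (x : 'cV[R]_m.+1) : 'cV[R]_m.+1 :=
  x + barycentric a x j *: (a i - a j).

Lemma barycentric_slide_pt x l : barycentric a (slide_pt x) l =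
  barycentric a x l + barycentric a x j * ((l == i)%:R - (l == j)%:R).
Proof.
pose b := barycentric a x.
pose c l := b l + b j * ((l == i)%:R - (l == j)%:R).
have sum_delta (V : lmodType R) (G : 'I_m.+2 -> V) p :
    \sum_l (l == p)%:R *: G l = G p.
  rewrite (bigD1 p)//= eqxx scale1r big1 ?addr0// => q /negPf ->.
  by rewrite scale0r.
have c1 : \sum_l c l = 1.
  rewrite big_split/= (barycentric_sum a a_aff) -mulr_sumr sumrB.
  have d1 p : \sum_(l < m.+2) (l == p)%:R = 1 :> R.
    by rewrite (bigD1 p)//= eqxx big1 ?addr0// => q /negPf ->.
  by rewrite !d1 subrr mulr0 addr0.
have cx : \sum_l c l *: a l = slide_pt x.
  under eq_bigr do rewrite scalerDl -scalerA scalerBl.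
  rewrite big_split/= (barycentric_point a a_aff) -scaler_sumr sumrB.
  by rewrite !sum_delta.
by rewrite -cx (barycentric_unique a a_aff).
Qed.

Lemma slide_subproof (x : K) : F (slide_pt (val x)).
Proof.
have [/= x0 _] := (hullP a a_aff _ _).1 (set_mem (valP x)).
apply/(hullP a a_aff); split=> l; rewrite barycentric_slide_pt.
  have [->|lj] := eqVneq l j.
    by rewrite eq_sym (negPf ij) sub0r mulrN1 subrr.
  by rewrite subr0 addr_ge0// mulr_ge0.
rewrite inE negbK => /eqP ->.
by rewrite eqxx eq_sym (negPf ij) sub0r mulrN1 subrr.
Qed.

Definition slide (x : K) : F := point_of (slide_subproof x).

Lemma lam_slide l x : l != Some i -> l != Some j ->
  lam a l (val (slide x)) = lam a l (val x).
Proof.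
case: l => [l|//] li lj; rewrite /= barycentric_slide_pt.
have -> : (l == i) = false by apply: contraNF li => /eqP ->.
have -> : (l == j) = false by apply: contraNF lj => /eqP ->.
by rewrite subrr mulr0 addr0.
Qed.

Lemma lam_slide_i x : lam a (Some i) (val (slide x)) =
  lam a (Some i) (val x) + lam a (Some j) (val x).
Proof. by rewrite /= barycentric_slide_pt eqxx (negPf ij) subr0 mulr1. Qed.

(** The monomials used by [extension] only involve coordinates that [slide]
    preserves. In particular the result is independent of the chosen
    coefficients. *)
Lemma extension_slide d (p : F -> R) : real_poly F d%:Z p ->
  extension a d i j p = fun x => p (slide x).
Proof.
move=> /real_poly_face_dehomP/bary_combP[c pc].
rewrite /extension; case: xgetP => [q _ [c' [pc' ->]]|/(_ (bary_comb a K
    [:: Some i; Some j] c))[]]; last by exists c.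
apply/funext => x; rewrite pc'; apply: eq_bigr => al /andP[_ alh].
congr (_ * _); apply: eq_bigr => l _; have [->|li] := eqVneq l (Some i).
  have := allP alh (Some i); rewrite !inE eqxx => /(_ isT)/eqP ->.
  by rewrite !expr0.
have [->|lj] := eqVneq l (Some j).
  have := allP alh (Some j); rewrite !inE eqxx orbT => /(_ isT)/eqP ->.
  by rewrite !expr0.
by rewrite lam_slide.
Qed.

Lemma slide_form d (p : F -> R) : real_poly F d%:Z p ->
  form (lam_gens a K [:: None]) d (fun x => p (slide x)).
Proof.
move=> /real_poly_faceP; apply: form_comp => y [[l|//] lh ->].
have lj : Some l != Some j by apply: contraNneq lh => ->; rewrite !inE eqxx orbT.
have gK l' : form (lam_gens a K [:: None]) 1 (fun x : K => lam a (Some l') (val x)).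
  by apply: form_gen; exists (Some l').
have [->|li] := eqVneq (Some l) (Some i).
  by apply: form_ext (form_add _ _ _ _ (gK i) (gK j)) => x; rewrite -lam_slide_i.
by apply: form_ext (gK l) => x; rewrite lam_slide.
Qed.

Lemma slide_lift d (g : K -> R) :
  form (lam_gens a K [:: None; Some i; Some j]) d g ->
  exists2 p, form (lam_gens a F [:: None; Some i; Some j]) d p &
    g = fun x => p (slide x).
Proof.
move=> hg; have [|p hp pE] := form_transfer _
  (lam_gens a F [:: None; Some i; Some j]) (fun y x => y = slide x) _ _ _ hg.
  move=> y [l lh ->]; exists (fun y : F => lam a l (val y)).
    by apply: form_gen; exists l.
  move=> u x ->; apply: lam_slide; apply: contraNneq lh => ->.
    by rewrite !inE eqxx.
  by rewrite !inE eqxx orbT.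
by exists p => //; apply/funext => x; rewrite (pE (slide x) x).
Qed.

Lemma slide_id (x : K) (y : F) : val x = val y -> slide x = y.
Proof.
move=> xy; apply: val_inj; rewrite /= /slide_pt xy face_lam0 scale0r.
by rewrite addr0.
Qed.

Lemma face_sub (y : F) : exists x : K, val x = val y.
Proof.
have [y0 _] := (hullP a a_aff _ _).1 (set_mem (valP y)).
have Ky : K (val y) by apply/(hullP a a_aff).
by exists (point_of Ky).
Qed.

Variable k : nat.

Let lami (x : K) := lam a (Some i) (val x).
Let lamj (x : K) := lam a (Some j) (val x).

(** Splitting off [lambda_i] and [lambda_j] leaves a form [g' o slide] in the
    other coordinates; [g'] is made orthogonal to degree [k] by subtracting a
    multiple [lambda_i q]. *)
Lemma edge_decomposition f : real_poly K k.+1%:Z f ->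
  exists u v w p,
  [/\ real_poly K (k%:Z - 1) u, form (lam_gens a K [:: None; Some j]) k v,
      form (lam_gens a K [:: None; Some i]) k w, perp_poly a j k p &
      f = fun x => lami x * (lamj x * u x) + (lami x * v x + lamj x * w x)
                   + p (slide x)].
Proof.
move=> /(real_poly_simplexP a a_aff) hf.
have [f1 [f2 [hf1 hf2 ->]]] := lam_gens_split _ _ i _ _ _ hf.
have [u1 [v1 [hu1 hv1 ->]]] := simplex_split a a_aff j _ _ hf1.
have {}hf2 : form (lam_gens a K [:: None; Some i]) k.+1 f2.
  apply: form_change hf2 => y [l lh ->]; apply: form_gen; exists l => //.
  by move: lh; rewrite !inE orbC.
have [w1 [g [hw1 hg ->]]] := lam_gens_split _ _ j _ _ _ hf2.
have {hg}/slide_lift[g' hg' ->] : form (lam_gens a K [:: None; Some i; Some j]) k.+1 g.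
  apply: form_change hg => y [l lh ->]; apply: form_gen; exists l => //.
  by move: lh; rewrite !inE !negb_or => /and3P[-> -> ->].
have {}hg' : form (lam_gens a F [:: None; Some j]) k.+1 g'.
  apply: form_change hg' => y [l lh ->]; apply: form_gen; exists l => //.
  by move: lh; rewrite !inE !negb_or => /and3P[-> _ ->].
have [q hq qP] := face_int_riesz a a_aff j i k [:: None; Some j] _ _ ij
  (face_form_sub _ _ _ _ _ hg').
have hq' := slide_form _ _ ((real_poly_faceP _ _).2 hq).
(* The correction [(lambda_i + lambda_j) (q o slide)] is distributed: in front
   of [lambda_i], [q o slide] is split along [lambda_j], and conversely. *)
have [u2 [v2 [hu2 hv2 q2]]] := simplex_split a a_aff j _ _ hq'.
have [u3 [w3 [hu3 hw3 q3]]] := simplex_split a a_aff i _ _ hq'.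
exists (fun x => u1 x + (u2 x + u3 x)), (fun x => v1 x + v2 x).
exists (fun x => w1 x + w3 x).
exists (fun y => g' y - lam a (Some i) (val y) * q y); split.
- by apply: lspan_add => //; exact: lspan_add.
- exact: form_add.
- exact: form_add.
- split.
    apply/real_poly_faceP; apply: form_sub => //.
    apply: (form_genM _ _ (fun y : F => lam a (Some i) (val y))) hq.
    by exists (Some i); rewrite // !inE.
  by move=> r /real_poly_faceP/qP; rewrite face_dotE.
apply/funext => x; rewrite lam_slide_i.
have q2x : q (slide x) = lamj x * u2 x + v2 x by rewrite (congr1 (@^~ x) q2).
have q3x : q (slide x) = lami x * u3 x + w3 x by rewrite (congr1 (@^~ x) q3).
rewrite mulrDl {1}q2x q3x -/(lami x) -/(lamj x); ring.
Qed.

(** On [lambda_j = 0] the sum is [lambda_i v], a form of positive degree in the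
    coordinates other than [lambda_j]; exchange [i] and [j] for the other
    term. *)
Lemma hf_pair_eq0 v w :
  form (lam_gens a K [:: None; Some j]) k v ->
  form (lam_gens a K [:: None; Some i]) k w ->
  (forall x : K, lami x * lamj x = 0 -> lami x * v x + lamj x * w x = 0) ->
  (forall x, lami x * v x = 0) /\ (forall x, lamj x * w x = 0).
Proof.
move=> hv hw vw0; split.
  apply: (form_hull_eq0 a a_aff predT j [:: None; Some j] k
    (fun x => lami x * v x)).
  - by rewrite !inE.
  - by rewrite !inE eqxx orbT.
  - apply: form_genM hv.
    by exists (Some i); rewrite // !inE.
  move=> x xj; have := vw0 x; rewrite /lamj /= xj mulr0 mul0r addr0.
  exact.
apply: (form_hull_eq0 a a_aff predT i [:: None; Some i] k
  (fun x => lamj x * w x)).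
- by rewrite !inE.
- by rewrite !inE eqxx orbT.
- apply: form_genM hw.
  by exists (Some j) => //; rewrite !inE /= eq_sym.
move=> x xi; have := vw0 x; rewrite /lami /= xi !mul0r add0r.
exact.
Qed.

(** The part of [p] not divisible by [lambda_i] is a form in the remaining
    coordinates that vanishes where [lambda_i] does, hence everywhere. So
    [p = lambda_i q], and testing orthogonality against [q] gives [q = 0]. *)
Lemma perp_eq0 p : perp_poly a j k p ->
  (forall y : F, barycentric a (val y) i = 0 -> p y = 0) -> p = fun=> 0.
Proof.
move=> [hp p_perp] p0.
have [q [h [hq hh pE]]] := lam_gens_split _ _ i _ _ _ ((real_poly_faceP _ _).1 hp).
have h0 : forall y : F, h y = 0.
  apply: (form_hull_eq0 a a_aff _ i _ k _ _ _ hh) => [||y yi].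
  - by rewrite !inE.
  - by rewrite !inE eqxx.
  - by have := p0 y yi; rewrite pE /= yi mul0r add0r.
have {}pE : p = fun y => lam a (Some i) (val y) * q y.
  by rewrite pE; apply/funext => y; rewrite h0 addr0.
have q0 : q = fun=> 0.
  apply: (face_int_definite a a_aff j k i q ij (face_form_sub _ _ _ _ _ hq)).
  rewrite -(p_perp q ((real_poly_faceP _ _).2 hq)) face_dotE pE.
  by congr face_int; apply/funext => y; rewrite mulrA.
by rewrite pE q0; apply/funext => y; rewrite mulr0.
Qed.

Lemma edge_direct u v w p :
  form (lam_gens a K [:: None; Some j]) k v ->
  form (lam_gens a K [:: None; Some i]) k w -> perp_poly a j k p ->
  (forall x, lami x * (lamj x * u x) + (lami x * v x + lamj x * w x)
             + p (slide x) = 0) ->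
  [/\ forall x, lami x * (lamj x * u x) = 0,
      forall x, lami x * v x + lamj x * w x = 0 & p = fun=> 0].
Proof.
move=> hv hw hp sum0; have p0 : p = fun=> 0.
  apply: (perp_eq0 _ hp) => y yi; have [x xy] := face_sub y.
  have := sum0 x; rewrite (slide_id _ _ xy) /lami /lamj /= xy yi face_lam0.
  by rewrite !mul0r !add0r.
have {}sum0 x : lami x * (lamj x * u x) + (lami x * v x + lamj x * w x) = 0.
  by rewrite -[RHS](sum0 x) p0 addr0.
have [v0 w0] : (forall x, lami x * v x = 0) /\ (forall x, lamj x * w x = 0).
  apply: hf_pair_eq0 => // x ll0; have := sum0 x.
  by rewrite mulrA ll0 mul0r add0r.
split=> // x; last by rewrite v0 w0 addr0.
by have := sum0 x; rewrite v0 w0 !addr0.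
Qed.

End edge.

(** * From scalar to symmetric matrix-valued polynomials *)

Section matrix_valued.
Context {R : realType} {n : nat} (a : 'I_n.+1 -> 'cV[R]_n).
Hypothesis a_aff : affinely_independent a.
Local Notation E := (edge_mx_of a).

Lemma edge_mx_of_sym e : (E e)^T = E e.
Proof. by rewrite /edge_mx_of /edge_mx trmx_mul trmxK. Qed.

Let scale_neq0 (e : edge_index n) :
  enorm (a (val e).2 - a (val e).1) ^- 2 != 0.
Proof.
rewrite invr_eq0 expf_neq0//; apply: (edge_norm_neq0 a a_aff).
case: e => [[i j] /= ij]; apply: contraTneq ij => ->.
by rewrite ltnn.
Qed.

Lemma edge_mx_free (c c' : edge_index n -> R) :
  \sum_e c e *: E e = \sum_e c' e *: E e -> c = c'.
Proof.
move=> cc'; apply/funext => e.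
have := grad_form_edges a a_aff c e; rewrite cc' (grad_form_edges a a_aff).
by move=> /oppr_inj/(mulfI (scale_neq0 e)).
Qed.

Lemma edge_mx_span (A : 'M[R]_n) : A^T = A ->
  exists c : edge_index n -> R, A = \sum_e c e *: E e.
Proof.
move=> AT; exists (fun e => - enorm (a (val e).2 - a (val e).1) ^+ 2 *
  grad_form a (val e).1 (val e).2 A).
apply/eqP; rewrite -subr_eq0; apply/eqP; apply: (sym_grad_form_inj a a_aff).
  rewrite linearB/= AT linear_sum/=; congr (_ - _).
  by apply: eq_bigr => e _; rewrite linearZ/= edge_mx_of_sym.
move=> e; rewrite linearB/= (grad_form_edges a a_aff) opprK mulNr mulrN mulKf ?subrr//.
by have := scale_neq0 e; rewrite invr_eq0.
Qed.

Lemma sym_polyE (D : set 'cV[R]_n) (d : int) (f : D -> 'M[R]_n) :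
  sym_poly D d f <-> exists2 q : edge_index n -> D -> R,
    forall e, real_poly D d (q e) & f = fun x => \sum_e q e x *: E e.
Proof.
split.
  apply: (lspan_ind _ (fun f => exists2 q : edge_index n -> D -> R,
    forall e, real_poly D d (q e) & f = fun x => \sum_e q e x *: E e)).
  - exists (fun _ _ => 0); first by move=> e; exact: lspan_zero.
    by apply/funext => x; rewrite big1// => e _; rewrite scale0r.
  - move=> _ _ [q hq ->] [q' hq' ->]; exists (fun e x => q e x + q' e x).
      by move=> e; exact: lspan_add (hq e) (hq' e).
    apply/funext => x; rewrite -[LHS]big_split/=.
    by apply: eq_bigr => e _; rewrite scalerDl.
  move=> c v [al [A [ald AT ->]]]; have [b ->] := edge_mx_span A AT.
  exists (fun e (x : D) => c * (\prod_(l < n) val x l ord0 ^+ al l * b e)).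
    by move=> e; apply: lspan_gen; exists al, (b e).
  apply/funext => x; rewrite [LHS]scalerA scaler_sumr.
  by apply: eq_bigr => e _; rewrite !scalerA mulrA.
move=> [q hq ->].
rewrite (_ : (fun _ => _) = \sum_e (fun x => q e x *: E e)); last first.
  by rewrite fct_sumE.
elim/big_ind : _ => [|f1 f2|e _]; [exact: lspan_zero|exact: lspan_add|].
apply: (lspan_ind _ (fun p => sym_poly D d (fun x => p x *: E e)) _ _ _ _ (hq e)).
- rewrite (_ : (fun _ => _) = 0); first exact: lspan_zero.
  by apply/funext => x; rewrite scale0r.
- move=> u v hu hv.
  rewrite (_ : (fun _ => _) = (fun x => u x *: E e) + (fun x => v x *: E e)).
    exact: lspan_add.
  by apply/funext => x; rewrite scalerDl.
- move=> c v [al [b [ald _ ->]]].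
  rewrite (_ : (fun _ => _) =
    c *: (fun x : D => (\prod_(l < n) val x l ord0 ^+ al l) *: (b *: E e))).
    apply: lspan_gen; exists al, (b *: E e); split=> //.
    by rewrite /sym_mx /mkset linearZ/= edge_mx_of_sym.
  apply/funext => x; pose p := \prod_(l < n) val x l ord0 ^+ al l.
  rewrite -[LHS]/((c * (p * b)) *: E e) -[RHS]/(c *: (p *: (b *: E e))).
  by rewrite !scalerA mulrA.
Qed.

Local Notation K := (simplex a).
Local Notation mx_fam U := (fun e => times_mx a (U e) (E e)).

Lemma mx_fam_direct (U : edge_index n -> set (K -> R)) : direct (mx_fam U).
Proof.
have ex w : (forall e, mx_fam U e (w e)) -> exists p : edge_index n -> K -> R,
    forall e, U e (p e) /\ (fun x => p e x *: E e) = w e.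
  move=> hw; have /choice[p hp] : forall e, exists p : K -> R,
      U e p /\ (fun x => p x *: E e) = w e.
    by move=> e; have [p] := hw e; exists p.
  by exists p.
move=> w w' /ex[p hp] /ex[p' hp'] ww'; apply/funext => e.
rewrite -(hp e).2 -(hp' e).2.
suff -> : p e = p' e by [].
apply/funext => x.
have : (fun e => p e x) = (fun e => p' e x); last by move/(congr1 (@^~ e)).
apply: edge_mx_free; have := congr1 (@^~ x) ww'; rewrite !fct_sumE.
under eq_bigr do rewrite -(hp _).2.
by under [RHS]eq_bigr do rewrite -(hp' _).2.
Qed.

Lemma mx_sum_ofP (U : edge_index n -> set (K -> R)) (f : K -> 'M[R]_n) :
  sum_of (mx_fam U) f <-> exists2 q : edge_index n -> K -> R,
    forall e, U e (q e) & f = fun x => \sum_e q e x *: E e.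
Proof.
split=> [[w hw ->]|[q hq ->]].
  have /choice[q hq] : forall e, exists q : K -> R,
      U e q /\ (fun x => q x *: E e) = w e.
    by move=> e; have [q] := hw e; exists q.
  exists q => [e|]; first exact: (hq e).1.
  rewrite fct_sumE; apply/funext => x.
  by apply: eq_bigr => e _; rewrite -(hq e).2.
exists (fun e x => q e x *: E e); last by rewrite fct_sumE.
by move=> e; exists (q e).
Qed.

(** A sum of matrix-valued polynomials is computed coefficient by coefficient in
    the basis of edge matrices. *)
Lemma mx_direct_sum {I : finType} (P : I -> edge_index n -> set (K -> R))
    (d : int) :
  (forall e, is_direct_sum (real_poly K d) (P^~ e)) ->
  is_direct_sum (sym_poly K d) (fun i => sum_of (mx_fam (P i))).
Proof.
have sumE (q : I -> edge_index n -> K -> R) : \sum_i (fun x => \sum_e q i e x *: E e) =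
    fun x => \sum_e (\sum_i q i e x) *: E e.
  rewrite fct_sumE; apply/funext => x; rewrite exchange_big/=.
  by apply: eq_bigr => e _; rewrite scaler_suml.
move=> PP; split.
  move=> w w' hw hw'.
  have /choice[q hq] : forall i, exists q : edge_index n -> K -> R,
      (forall e, P i e (q e)) /\ w i = fun x => \sum_e q e x *: E e.
    by move=> i; have [q] := (mx_sum_ofP _ _).1 (hw i); exists q.
  have /choice[q' hq'] : forall i, exists q : edge_index n -> K -> R,
      (forall e, P i e (q e)) /\ w' i = fun x => \sum_e q e x *: E e.
    by move=> i; have [q0] := (mx_sum_ofP _ _).1 (hw' i); exists q0.
  under eq_bigr do rewrite (hq _).2.
  under [RHS]eq_bigr do rewrite (hq' _).2.
  rewrite !sumE => qq'; have {}qq' e : (fun i => q i e) = (fun i => q' i e).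
    apply: (PP e).1 => [i|i|]; [exact: (hq i).1|exact: (hq' i).1|].
    rewrite !fct_sumE; apply/funext => x.
    by have /edge_mx_free/(congr1 (@^~ e)) := congr1 (@^~ x) qq'.
  apply/funext => i; rewrite (hq i).2 (hq' i).2; apply/funext => x.
  by apply: eq_bigr => e _; rewrite (congr1 (@^~ i) (qq' e)).
apply/seteqP; split=> f.
  move=> /sym_polyE[q hq ->].
  have /choice[w hw] : forall e, exists w : I -> K -> R,
      (forall i, P i e (w i)) /\ q e = \sum_i w i.
    by move=> e; have := hq e; rewrite (PP e).2 => -[w]; exists w.
  exists (fun i x => \sum_e w e i x *: E e).
    move=> i; apply/mx_sum_ofP; exists (fun e => w e i) => // e.
    exact: (hw e).1.
  rewrite (sumE (fun i e => w e i)); apply/funext => x.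
  by apply: eq_bigr => e _; rewrite (hw e).2 fct_sumE.
move=> [w hw ->]; have /choice[q hq] : forall i, exists q : edge_index n -> K -> R,
    (forall e, P i e (q e)) /\ w i = fun x => \sum_e q e x *: E e.
  by move=> i; have [q] := (mx_sum_ofP _ _).1 (hw i); exists q.
under eq_bigr do rewrite (hq _).2.
rewrite sumE; apply/sym_polyE; exists (fun e => \sum_i q i e).
  by move=> e; rewrite (PP e).2; exists (fun i => q i e) => // i; exact: (hq i).1.
by apply/funext => x; apply: eq_bigr => e _; rewrite fct_sumE.
Qed.

End matrix_valued.

(** * The direct sums *)

Section assembly.
Context {R : realType} {m : nat} (a : 'I_m.+2 -> 'cV[R]_m.+1).
Hypothesis a_aff : affinely_independent a.
Variable k : nat.
Local Notation K := (simplex a).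

(** The scalar factor, at the edge [e], of the three spaces of the
    decomposition. *)
Definition edge_space (X : 'I_3) (e : edge_index m.+1) : set (K -> R) :=
  let: (i, j) := val e in
  tnth [tuple times_lam a i (times_lam a j (real_poly K (k%:Z - 1)));
              sum_of (tSigma_hf_pair a k e);
              extension a k.+1 i j @` perp_poly a j k] X.

Lemma edge_neq (e : edge_index m.+1) : (val e).1 != (val e).2.
Proof. by case: e => [[i j] /= ij]; apply: contraTneq ij => ->; rewrite ltnn. Qed.

Lemma tSigma_hf_pairP (e : edge_index m.+1) f : sum_of (tSigma_hf_pair a k e) f <->
  exists v w,
  [/\ form (lam_gens a K [:: None; Some (val e).2]) k v,
      form (lam_gens a K [:: None; Some (val e).1]) k w &
      f = fun x => lam a (Some (val e).1) (val x) * v x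
                   + lam a (Some (val e).2) (val x) * w x].
Proof.
case: e => [[i j] ij] /=; split=> [[p hp ->]|[v [w [hv hw ->]]]].
  have [v /hat_polyP hv vE] := hp ord0.
  have [w /hat_polyP hw wE] := hp (lift ord0 ord0).
  exists v, w; split=> //; rewrite !big_ord_recl big_ord0 addr0 -vE -wE.
  by [].
exists (fun X => tnth [tuple (fun x : K => lam a (Some i) (val x) * v x);
  (fun x : K => lam a (Some j) (val x) * w x)] X).
  move=> X; case: (unliftP ord0 X) => [Y|] ->.
    by rewrite ord1; exists w => //; exact/hat_polyP.
  by exists v => //; exact/hat_polyP.
by rewrite !big_ord_recl big_ord0 addr0.
Qed.

Lemma tSigma_hf_pair_direct (e : edge_index m.+1) : direct (tSigma_hf_pair a k e).
Proof.
case: e => [[i j] ij] w w' hw hw' ww'.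
have ij' := edge_neq (exist _ (i, j) ij).
have [v /hat_polyP hv vE] := hw ord0.
have [u /hat_polyP hu uE] := hw (lift ord0 ord0).
have [v' /hat_polyP hv' vE'] := hw' ord0.
have [u' /hat_polyP hu' uE'] := hw' (lift ord0 ord0).
have [|v0 u0] := hf_pair_eq0 a a_aff i j ij' k _ _
  (form_sub _ _ _ _ hv hv') (form_sub _ _ _ _ hu hu').
  move=> x _; have := congr1 (@^~ x) ww'.
  rewrite !big_ord_recl !big_ord0 !addr0 -vE -uE -vE' -uE' => H.
  apply/eqP; rewrite !mulrBr addrACA -opprD subr_eq0; apply/eqP; exact: H.
apply/funext => X; case: (unliftP ord0 X) => [Y|] ->.
  rewrite ord1 -uE -uE'; apply/funext => x; apply/eqP.
  by rewrite -subr_eq0 -mulrBr; apply/eqP; exact: u0.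
rewrite -vE -vE'; apply/funext => x; apply/eqP.
by rewrite -subr_eq0 -mulrBr; apply/eqP; exact: v0.
Qed.

Lemma perp_poly_sub j p p' :
  perp_poly a j k p -> perp_poly a j k p' -> perp_poly a j k (fun x => p x - p' x).
Proof.
move=> [hp pP] [hp' pP'].
have ff d (r : face a j -> R) : real_poly (face a j) d%:Z r -> face_form a j d r.
  by move=> /(real_poly_faceP a a_aff)/face_form_sub.
split.
  by apply/(real_poly_faceP a a_aff)/form_sub; exact/(real_poly_faceP a a_aff).
move=> r hr; have pr := form_mul _ _ _ _ _ (ff _ _ hp) (ff _ _ hr).
have pr' := form_mul _ _ _ _ _ (ff _ _ hp') (ff _ _ hr).
transitivity (face_dot a p r + (- 1) * face_dot a p' r).
  rewrite !face_dotE -(face_int_lin a a_aff j _ _ _ _ _ pr pr').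
  by congr face_int; apply/funext => x; rewrite mulrBl mulN1r.
by rewrite pP// pP'// mulr0 addr0.
Qed.

Lemma edge_space_direct_sum e :
  is_direct_sum (real_poly K k.+1%:Z) (edge_space^~ e).
Proof.
have ij := edge_neq e; have hfP := tSigma_hf_pairP e.
case: e ij hfP => [[i j] ijlt] /= ij hfP.
pose o1 : 'I_3 := lift ord0 ord0; pose o2 : 'I_3 := lift ord0 (lift ord0 ord0).
have sum3 (w : 'I_3 -> K -> R) x : (\sum_X w X) x = w ord0 x + w o1 x + w o2 x.
  by rewrite fct_sumE !big_ord_recl big_ord0 addr0 addrA.
have ind3 (Q : 'I_3 -> Prop) : Q ord0 -> Q o1 -> Q o2 -> forall X, Q X.
  move=> Q0 Q1 Q2 X; case: (unliftP ord0 X) => [Y|] -> //.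
  by case: (unliftP ord0 Y) => [Z|] -> //; rewrite ord1.
pose e : edge_index m.+1 := exist _ (i, j) ijlt.
have elim3 w : (forall X, edge_space X e (w X)) ->
    exists u v v' p, [/\ form (lam_gens a K [:: None; Some j]) k v,
      form (lam_gens a K [:: None; Some i]) k v', perp_poly a j k p &
      [/\ w ord0 = fun x => lam a (Some i) (val x) * (lam a (Some j) (val x) * u x),
      w o1 = fun x => lam a (Some i) (val x) * v x + lam a (Some j) (val x) * v' x &
      w o2 = fun x => p (slide a a_aff i j ij x)]].
  move=> hw; have [_ [u _ <-] w0] := hw ord0.
  have /hfP[v [v' [hv hv' w1]]] := hw o1.
  have [p hp w2] := hw o2.
  exists u, v, v', p; split=> //; split=> //.
  by rewrite -w2 (extension_slide a a_aff i j ij)//; case: hp.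
split.
  move=> w w' /elim3[u [v [z [p [hv hz hp [w0 w1 w2]]]]]].
  move=> /elim3[u' [v' [z' [p' [hv' hz' hp' [w0' w1' w2']]]]]] ww'.
  have [|d0 d1 d2] := edge_direct a a_aff i j ij k (fun x => u x - u' x) _ _ _
      (form_sub _ _ _ _ hv hv') (form_sub _ _ _ _ hz hz') (perp_poly_sub _ _ _ hp hp').
    move=> x; have := congr1 (@^~ x) ww'; rewrite /= !sum3 w0 w1 w2 w0' w1' w2'.
    by move=> /eqP; rewrite -subr_eq0 => /eqP H; rewrite -[RHS]H /=; ring.
  apply/funext; apply: ind3.
  - rewrite w0 w0'; apply/funext => x; apply/eqP; rewrite -subr_eq0.
    by rewrite -!mulrBr d0.
  - rewrite w1 w1'; apply/funext => x; apply/eqP; rewrite -subr_eq0.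
    by rewrite -[X in _ == X](d1 x); apply/eqP; ring.
  - rewrite w2 w2'; apply/funext => x; apply/eqP; rewrite -subr_eq0.
    by rewrite (congr1 (@^~ (slide a a_aff i j ij x)) d2).
apply/seteqP; split=> f.
  move=> /(edge_decomposition a a_aff i j ij)[u [v [z [p [hu hv hz hp ->]]]]].
  exists (fun X => tnth [tuple
    (fun x : K => lam a (Some i) (val x) * (lam a (Some j) (val x) * u x));
    (fun x : K => lam a (Some i) (val x) * v x + lam a (Some j) (val x) * z x);
    (fun x : K => p (slide a a_aff i j ij x))] X).
    apply: ind3.
    - by exists (fun x => lam a (Some j) (val x) * u x) => //; exists u.
    - by apply/hfP; exists v, z.
    - by exists p => //; rewrite (extension_slide a a_aff i j ij)//; case: hp.
  by apply/funext => x; rewrite sum3.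
move=> [w hw ->]; have [_ [u hu <-] w0] := hw ord0.
have /elim3[_ [v [z [p [hv hz hp [_ w1 w2]]]]]] := hw.
apply/(real_poly_simplexP a a_aff).
have gl l d (g : K -> R) : form (lam_gens a K [:: None]) d g ->
    form (lam_gens a K [:: None]) d.+1 (fun x => lam a (Some l) (val x) * g x).
  move=> hg; apply: (form_genM _ _ (fun x : K => lam a (Some l) (val x))) hg.
  by exists (Some l).
have gh h d (g : K -> R) : None \in h -> form (lam_gens a K h) d g ->
    form (lam_gens a K [:: None]) d g.
  move=> Nh; apply: form_change => y [l lh ->]; apply: form_gen; exists l => //.
  by rewrite inE; apply: contraNneq lh => ->.
have -> : \sum_X w X = fun x => w ord0 x + w o1 x + w o2 x.
  by apply/funext => x; rewrite sum3.
rewrite w1 w2 -w0; apply: form_add; [apply: form_add|].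
- by apply: (gl i); exact: (form_lam_mul a a_aff).
- by apply: form_add; apply: gl; [exact: gh hv|exact: gh hz].
- by apply: (slide_form a a_aff i j ij); case: hp.
Qed.

Lemma edge_familyE (X : 'I_3) :
  tnth [tuple Sigma_hb_fam a k; tSigma_hf_fam a k; tSigma_hb_fam a k] X =
  fun e => times_mx a (edge_space X e) (edge_mx_of a e).
Proof.
apply/funext => -[[i j] ij].
case: (unliftP ord0 X) => [Y|] ->; last by [].
case: (unliftP ord0 Y) => [Z|] ->; last by [].
by rewrite ord1.
Qed.

End assembly.

Theorem theorem2p8 (R : realType) (n : nat) (n_ge2 : (2 <= n)%N)
    (a : 'I_n.+1 -> 'cV[R]_n) (a_aff : affinely_independent a) (k : nat) :
  [/\ direct (Sigma_hb_fam a k),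
      forall e : edge_index n, direct (tSigma_hf_pair a k e),
      direct (tSigma_hf_fam a k),
      direct (tSigma_hb_fam a k) &
      is_direct_sum (sym_poly (simplex a) k.+1%:Z)
        (tnth [tuple Sigma_hb a k; tSigma_hf a k; tSigma_hb a k])].
Proof.
case: n n_ge2 a a_aff => // m _ a a_aff.
pose o1 : 'I_3 := lift ord0 ord0; pose o2 : 'I_3 := lift ord0 (lift ord0 ord0).
have fam X := edge_familyE a k X.
split.
- have -> : Sigma_hb_fam a k = _ := fam ord0.
  exact: mx_fam_direct.
- exact: tSigma_hf_pair_direct.
- have -> : tSigma_hf_fam a k = _ := fam o1.
  exact: mx_fam_direct.
- have -> : tSigma_hb_fam a k = _ := fam o2.
  exact: mx_fam_direct.
have -> : tnth [tuple Sigma_hb a k; tSigma_hf a k; tSigma_hb a k] =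
    fun X => sum_of (fun e => times_mx a (edge_space a k X e) (edge_mx_of a e)).
  apply/funext => X; rewrite -fam.
  case: (unliftP ord0 X) => [Y|] -> //.
  by case: (unliftP ord0 Y) => [Z|] -> //; rewrite ord1.
by apply: mx_direct_sum => // e; exact: edge_space_direct_sum.
Qed.
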